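(* Let $g\in H(\mathbb{D})$ be a non-constant function and let $v\colon [0,1)\to(0,\infty)$ be a log-convex weight function such that $\lim_{r\to 1^-}v(r)=0$ and such that there exist $\alpha>0$ and $r_0\in(0,1)$ for which $r\mapsto v(r)(1-r)^{-\alpha}$ is increasing on $[r_0,1)$. If the Volterra operator $V_g\colon H^0_v\to H^0_v$ is compact, then $H^\infty_v$ is a proper subspace of the optimal domain $[V_g,H^0_v]$.
   Context: $\mathbb{D}=\{z\in\mathbb{C}:|z|<1\}$ and $H(\mathbb{D})$ is the Fréchet space of all analytic functions on $\mathbb{D}$ with the topology of uniform convergence on compact sets. For $g\in H(\mathbb{D})$, the Volterra operator $V_g\colon H(\mathbb{D})\to H(\mathbb{D})$ is $(V_gf)(z):=\int_0^z f(\xi)g'(\xi)\,d\xi$. A weight is a continuous, non-increasing function $v\colon[0,1)\to(0,\infty)$, extended to $\mathbb{D}$ by $v(z):=v(|z|)$. It is log-convex if $x\mapsto -\log v(e^x)$ is convex on $(-\infty,0)$. Define $H^\infty_v:=\{f\in H(\mathbb{D}):\|f\|_{\infty,v}:=\sup_{z\in\mathbb{D}}|f(z)|v(z)<\infty\}$ and $H^0_v:=\{f\in H(\mathbb{D}):\lim_{|z|\to1^-}|f(z)|v(z)=0\}$, both with norm $\|\cdot\|_{\infty,v}$. For $X$ a Banach space continuously included in $H(\mathbb{D})$ and $T\colon H(\mathbb{D})\to H(\mathbb{D})$ continuous linear with $T(X)\subseteq X$, the optimal domain is $[T,X]:=\{f\in H(\mathbb{D}):Tf\in X\}$ with (semi-)norm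 $\|f\|_{[T,X]}:=\|Tf\|_X$. Saying that $T\colon X\to X$ is continuous (compact) includes that $T(X)\subseteq X$. *)

(* Defs.v *)
From Stdlib Require Import Reals List.
From Coquelicot Require Import Coquelicot.

Open Scope R_scope.

(* A function on the unit disc is represented by a total function [C -> C];
   its values outside the disc are irrelevant: membership in the spaces below
   and their norms do not depend on them. *)

Definition disc (z : C) : Prop := Cmod z < 1.

Definition analytic (f : C -> C) : Prop :=
  forall z : C, disc z -> ex_derive (K := C_AbsRing) (V := C_NormedModule) f z.

Definition non_constant (f : C -> C) : Prop :=
  ~ exists c : C, forall z : C, disc z -> f z = c.

(* The path of integration from 0 to z is the segment xi = t z, 0 <= t <= 1. *)
Definition volterra (g f : C -> C) (z : C) : C :=
  RInt (V := C_R_CompleteNormedModule)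
    (fun t : R => (f (RtoC t * z) * C_derive g (RtoC t * z) * z)%C) 0 1.

Definition weight (v : R -> R) : Prop :=
  (forall r : R, 0 <= r < 1 -> 0 < v r) /\
  continuous_on (fun r : R => 0 <= r < 1) v /\
  (forall r s : R, 0 <= r -> r <= s -> s < 1 -> v s <= v r).

Definition convex_on (D : R -> Prop) (phi : R -> R) : Prop :=
  forall x y t : R, D x -> D y -> 0 <= t <= 1 ->
    phi (t * x + (1 - t) * y) <= t * phi x + (1 - t) * phi y.

Definition log_convex (v : R -> R) : Prop :=
  convex_on (fun x : R => x < 0) (fun x : R => - ln (v (exp x))).

Definition increasing_on (D : R -> Prop) (phi : R -> R) : Prop :=
  forall r s : R, D r -> D s -> r <= s -> phi r <= phi s.

Definition weighted_modulus (v : R -> R) (f : C -> C) (z : C) : R :=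
  Cmod (f z) * v (Cmod z).

Definition weighted_sup (v : R -> R) (f : C -> C) : Rbar :=
  Lub_Rbar (fun x : R => exists z : C, disc z /\ x = weighted_modulus v f z).

Definition weighted_norm (v : R -> R) (f : C -> C) : R :=
  real (weighted_sup v f).

Definition H_infty (v : R -> R) (f : C -> C) : Prop :=
  analytic f /\ is_finite (weighted_sup v f).

(* The filter |z| -> 1^-. *)
Definition to_circle (P : C -> Prop) : Prop :=
  at_left 1 (fun r : R => forall z : C, Cmod z = r -> P z).

Definition H_zero (v : R -> R) (f : C -> C) : Prop :=
  analytic f /\ filterlim (weighted_modulus v f) to_circle (locally 0).

Definition optimal_domain (T : (C -> C) -> C -> C) (X : (C -> C) -> Prop)
    (f : C -> C) : Prop :=
  analytic f /\ X (T f).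

(* Topological notions in the space of functions [X] with (semi)norm [N]; since
   functions that agree on the disc are at distance 0, these are the notions of
   the associated normed space of functions on the disc. *)
Definition norm_ball (X : (C -> C) -> Prop) (N : (C -> C) -> R)
    (f : C -> C) (r : R) (h : C -> C) : Prop :=
  X h /\ N (fun z : C => (h z - f z)%C) < r.

Definition norm_open (X : (C -> C) -> Prop) (N : (C -> C) -> R)
    (U : (C -> C) -> Prop) : Prop :=
  forall f : C -> C, X f -> U f ->
    exists r : R, 0 < r /\ forall h : C -> C, norm_ball X N f r h -> U h.

Definition norm_closure (X : (C -> C) -> Prop) (N : (C -> C) -> R)
    (A : (C -> C) -> Prop) (f : C -> C) : Prop :=
  X f /\ forall r : R, 0 < r -> exists h : C -> C, A h /\ norm_ball X N f r h.

Definition norm_compact (X : (C -> C) -> Prop) (N : (C -> C) -> R)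
    (K : (C -> C) -> Prop) : Prop :=
  forall (I : Type) (U : I -> (C -> C) -> Prop),
    (forall i : I, norm_open X N (U i)) ->
    (forall f : C -> C, K f -> exists i : I, U i f) ->
    exists l : list I, forall f : C -> C, K f -> exists i : I, In i l /\ U i f.

Definition relatively_compact (X : (C -> C) -> Prop) (N : (C -> C) -> R)
    (A : (C -> C) -> Prop) : Prop :=
  norm_compact X N (norm_closure X N A).

Definition compact_operator (X : (C -> C) -> Prop) (N : (C -> C) -> R)
    (T : (C -> C) -> C -> C) : Prop :=
  (forall f : C -> C, X f -> X (T f)) /\
  relatively_compact X N (fun h : C -> C => exists f : C -> C,
    X f /\ N f <= 1 /\ h = T f).

Definition linear_subspace (A : (C -> C) -> Prop) : Prop :=
  A (fun _ : C => RtoC 0) /\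
  (forall f h : C -> C, A f -> A h -> A (fun z : C => (f z + h z)%C)) /\
  (forall (c : C) (f : C -> C), A f -> A (fun z : C => (c * f z)%C)).

Definition proper_subspace (A B : (C -> C) -> Prop) : Prop :=
  linear_subspace A /\ linear_subspace B /\
  (forall f : C -> C, A f -> B f) /\
  exists f : C -> C, B f /\ ~ A f.

(* Main.v *)
From Stdlib Require Import Reals List Lra Lia Classical ClassicalEpsilon.
From Coquelicot Require Import Coquelicot.
(* Last, since Stdlib's [Rtopology] also defines [disc]. *)
Require Import Defs.

(** Inclusion.  For [f] in the unit ball of [H_infty v] the dilates [f (r z)] lie in
the unit ball of [H_zero v] and converge to [f] locally uniformly as [r -> 1], so
[volterra g] of them converges pointwise to [volterra g f].  By compactness these
images have a cluster point in [H_zero v], which can only be the pointwise limit.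

Properness.  The normalised monomials [e_k = z^k / ||z^k||] tend to [0] locally
uniformly because [v] tends to [0] at the circle, so by the same argument the norms
of [volterra g e_k] are arbitrarily small along a subsequence.  Choosing indices
[k_n] with [||volterra g e_(k_n)|| <= 4^-n], the series [sum 2^n e_(k_n)] converges
to an analytic function whose image lies in [H_zero v]; its coefficients are
nonnegative, so its weighted norm is at least [2^n] for every [n].

Both parts use that locally uniform limits of analytic functions are analytic and
that derivatives are continuous, which comes from Cauchy's formula; the latter is
obtained from Goursat's bisection argument carried out in the parameter square of a
homotopy between two circles. *)

(** * Two-dimensional Cousin lemma *)

(** [analytic] only asks for a complex derivative at each point, so the continuity of [C_derive g],
    on which the integral in [volterra] depends, has to be earned. The Cauchy theory is therefore
    aimed at one uniform second-order estimate on closed discs: it yields both the Lipschitz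
    property of the derivative and the differentiability of limits.

    Analyticity of [volterra g f] is never read off the integral. It comes with membership in
    [H_zero], either from the cluster point supplied by compactness or as a locally uniform limit of
    images that [compact_operator] already places in [H_zero].

    The rates 2 and 4 are balanced: [2 ^ n * (1 / 4) ^ n = (1 / 2) ^ n] is summable, both for the
    weighted norms of the images and for the terms themselves on discs exhausting the unit disc,
    while the factors [2 ^ n] still force an unbounded weighted modulus. Nonnegative coefficients
    exclude cancellation on the positive radius, and since the weighted modulus of a monomial
    depends on the radius alone, its whole norm is visible there. *)

Section Cousin.
Variables (P : R -> R -> R -> Prop) (a0 c0 L0 : R).
Hypothesis L0_pos : 0 < L0.
Hypothesis P_merge : forall a c L, 0 < L ->
  P a c (L / 2) -> P (a + L / 2) c (L / 2) ->
  P a (c + L / 2) (L / 2) -> P (a + L / 2) (c + L / 2) (L / 2) -> P a c L.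
Hypothesis P_local : forall x y, a0 <= x <= a0 + L0 -> c0 <= y <= c0 + L0 ->
  exists d, 0 < d /\ forall a c L, 0 < L < d ->
    a <= x <= a + L -> c <= y <= c + L -> P a c L.

Lemma bad_quarter (a c L : R) : 0 < L -> ~ P a c L ->
  exists u w : R, ~ P u w (L / 2) /\
    a <= u /\ u + L / 2 <= a + L /\ c <= w /\ w + L / 2 <= c + L.
Proof using P_merge.
  intros HL HP.
  apply NNPP; intros Hn; apply HP.
  apply P_merge; [assumption| | | |]; apply NNPP; intros Hq; apply Hn;
    eexists; eexists; split; try exact Hq; lra.
Qed.

(** Chosen by [epsilon] so that the recursion carries no proof that the current square is bad;
    [inhabits p] only witnesses that the type is inhabited. *)
Definition bad_next (p : R * R) (L : R) : R * R :=
  epsilon (inhabits p) (fun q : R * R => ~ P (fst q) (snd q) (L / 2) /\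
    fst p <= fst q /\ fst q + L / 2 <= fst p + L /\
    snd p <= snd q /\ snd q + L / 2 <= snd p + L).

Fixpoint bad_corner (n : nat) : R * R :=
  match n with
  | O => (a0, c0)
  | S k => bad_next (bad_corner k) (L0 / 2 ^ k)
  end.

Lemma half_pow (n : nat) : L0 / 2 ^ S n = L0 / 2 ^ n / 2.
Proof using. simpl. field. apply pow_nonzero; lra. Qed.

Lemma side_pos (n : nat) : 0 < L0 / 2 ^ n.
Proof using L0_pos. apply Rdiv_lt_0_compat; [lra|apply pow_lt; lra]. Qed.

Lemma bad_next_spec (p : R * R) (L : R) : 0 < L -> ~ P (fst p) (snd p) L ->
  let q := bad_next p L in
  ~ P (fst q) (snd q) (L / 2) /\
    fst p <= fst q /\ fst q + L / 2 <= fst p + L /\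
    snd p <= snd q /\ snd q + L / 2 <= snd p + L.
Proof using P_merge.
  intros HL HP. unfold bad_next.
  apply (epsilon_spec (inhabits p) (fun q : R * R => ~ P (fst q) (snd q) (L / 2) /\
    fst p <= fst q /\ fst q + L / 2 <= fst p + L /\
    snd p <= snd q /\ snd q + L / 2 <= snd p + L)).
  destruct (bad_quarter _ _ _ HL HP) as (u & w & H).
  exists (u, w); exact H.
Qed.

Lemma nested_limit (u : nat -> R) :
  (forall n, u n <= u (S n)) ->
  (forall n, u (S n) + L0 / 2 ^ S n <= u n + L0 / 2 ^ n) ->
  exists x, forall n, u n <= x <= u n + L0 / 2 ^ n.
Proof using L0_pos.
  intros H1 H2.
  assert (Hup : forall n k, u n <= u (n + k)%nat /\
     u (n + k)%nat + L0 / 2 ^ (n + k) <= u n + L0 / 2 ^ n).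
  { intros n; induction k.
    - rewrite Nat.add_0_r; lra.
    - rewrite Nat.add_succ_r. specialize (H1 (n + k)%nat). specialize (H2 (n + k)%nat). lra. }
  destruct (completeness (fun x => exists n, x = u n)) as [x [Hx1 Hx2]].
  - exists (u O + L0 / 2 ^ 0). intros y [n ->].
    specialize (Hup O n). rewrite Nat.add_0_l in Hup. pose proof (side_pos n). lra.
  - exists (u O); exists O; reflexivity.
  - exists x. intros n; split.
    + apply Hx1; exists n; reflexivity.
    + apply Hx2. intros y [m ->].
      destruct (Nat.le_ge_cases m n) as [Hm|Hm].
      * replace n with (m + (n - m))%nat at 1 by lia.
        pose proof (proj1 (Hup m (n - m)%nat)). pose proof (side_pos n).
        replace (m + (n - m))%nat with n in * by lia. lra.
      * pose proof (proj2 (Hup n (m - n)%nat)).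
        replace (n + (m - n))%nat with m in * by lia. pose proof (side_pos m). lra.
Qed.

(** Every bad square has a bad quarter, and nested bad squares shrink to a point near which
    [P_local] makes all small squares good. This plays the role of compactness of a square, both in
    the Goursat estimate and in bounding functions on closed discs. *)
Lemma cousin_square : P a0 c0 L0.
Proof using P_merge P_local L0_pos.
  apply NNPP; intros Hbad.
  assert (Hb : forall n, ~ P (fst (bad_corner n)) (snd (bad_corner n)) (L0 / 2 ^ n)).
  { induction n.
    - simpl. replace (L0 / 1) with L0 by field. exact Hbad.
    - rewrite half_pow. apply (bad_next_spec _ _ (side_pos n) IHn). }
  assert (Hs := fun n => bad_next_spec _ _ (side_pos n) (Hb n)).
  destruct (nested_limit (fun n => fst (bad_corner n))) as [x Hx].
  { intros n. apply (Hs n). }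
  { intros n. rewrite half_pow. apply (Hs n). }
  destruct (nested_limit (fun n => snd (bad_corner n))) as [y Hy].
  { intros n. apply (Hs n). }
  { intros n. rewrite half_pow. apply (Hs n). }
  destruct (P_local x y) as (d & Hd & Hl).
  { specialize (Hx O). simpl in Hx. lra. }
  { specialize (Hy O). simpl in Hy. lra. }
  destruct (pow_lt_1_zero (/ 2)) with (y := d / L0) as [N HN].
  { rewrite Rabs_pos_eq; lra. }
  { apply Rdiv_lt_0_compat; lra. }
  apply (Hb N). apply Hl; [|apply Hx|apply Hy].
  split; [apply side_pos|].
  specialize (HN N (le_n _)). rewrite Rabs_pos_eq in HN by (apply pow_le; lra).
  rewrite pow_inv in HN. apply Rmult_lt_compat_r with (r := L0) in HN; [|lra].
  unfold Rdiv in *. rewrite Rmult_assoc, Rinv_l, Rmult_1_r in HN by lra. lra.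
Qed.
End Cousin.

(** * Complex-valued functions of a real variable *)

Lemma locally_C_iff (z : C) (P : C -> Prop) :
  locally (T := C_UniformSpace) z P <->
  exists d, 0 < d /\ forall w, Cmod (w - z) < d -> P w.
Proof.
  rewrite (locally_C z P). split.
  - intros [d Hd]. exists d. split; [apply cond_pos|]. intros w Hw. apply Hd. exact Hw.
  - intros (d & Hd & H). exists (mkposreal d Hd). intros w Hw. apply H. exact Hw.
Qed.

Definition ccont (f : R -> C) (t : R) : Prop := continuous (U := C_UniformSpace) f t.

Lemma ccont_iff (f : R -> C) (t : R) : ccont f t <->
  forall e, 0 < e -> exists d, 0 < d /\ forall s, Rabs (s - t) < d -> Cmod (f s - f t) < e.
Proof.
  split.
  - intros H e He. destruct (H (fun w => Cmod (w - f t) < e)) as [d Hd].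
    + apply locally_C_iff. exists e; auto.
    + exists d. split; [apply cond_pos|]. intros s Hs. apply Hd. exact Hs.
  - intros H Q HQ. apply locally_C_iff in HQ. destruct HQ as (e & He & HQ).
    destruct (H e He) as (d & Hd & Hs). exists (mkposreal d Hd).
    intros s Hs'. apply HQ, Hs, Hs'.
Qed.

(** [C] carries two uniform structures: the product one, used for integration, and the one of [Cmod]
    balls, in which [continuous_mult] is stated over [C_AbsRing]. They have the same
    neighbourhoods. *)
Lemma ccont_abs (f : R -> C) (t : R) :
  ccont f t <-> continuous (U := AbsRing_UniformSpace C_AbsRing) f t.
Proof.
  split; intros H Q HQ; apply H; apply locally_C; exact HQ.
Qed.

Lemma ccont_const (c : C) (t : R) : ccont (fun _ => c) t.
Proof. apply continuous_const. Qed.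

Lemma ccont_mult (f h : R -> C) (t : R) :
  ccont f t -> ccont h t -> ccont (fun s => f s * h s)%C t.
Proof.
  rewrite !ccont_abs. intros Hf Hh. exact (continuous_mult (K := C_AbsRing) f h t Hf Hh).
Qed.

Lemma ccont_plus (f h : R -> C) (t : R) :
  ccont f t -> ccont h t -> ccont (fun s => f s + h s)%C t.
Proof.
  intros Hf Hh. exact (continuous_plus (V := C_R_NormedModule) f h t Hf Hh).
Qed.

Lemma ccont_minus (f h : R -> C) (t : R) :
  ccont f t -> ccont h t -> ccont (fun s => f s - h s)%C t.
Proof.
  intros Hf Hh. exact (continuous_minus (V := C_R_NormedModule) f h t Hf Hh).
Qed.

Lemma ccont_RtoC (f : R -> R) (t : R) : continuous f t -> ccont (fun s => RtoC (f s)) t.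
Proof.
  intros Hf. apply ccont_iff. intros e He.
  destruct (Hf (fun w => Rabs (w - f t) < e)) as [d Hd].
  - exists (mkposreal e He). intros y Hy. exact Hy.
  - exists d. split; [apply cond_pos|]. intros s Hs. rewrite <- RtoC_minus, Cmod_R.
    apply Hd. exact Hs.
Qed.

Definition cderiv (f : R -> C) (t : R) (l : C) : Prop :=
  is_derive (K := R_AbsRing) (V := C_R_NormedModule) f t l.

Lemma cderiv_ext (f h : R -> C) (t : R) (l m : C) :
  (forall s, f s = h s) -> l = m -> cderiv f t l -> cderiv h t m.
Proof. intros H <-. apply is_derive_ext. exact H. Qed.

Lemma cderiv_plus (f h : R -> C) (t : R) (l m : C) :
  cderiv f t l -> cderiv h t m -> cderiv (fun s => f s + h s)%C t (l + m)%C.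
Proof. intros Hf Hh. exact (is_derive_plus (V := C_R_NormedModule) f h t l m Hf Hh). Qed.

Lemma cderiv_iff (f : R -> C) (t : R) (l : C) : cderiv f t l <->
  forall e, 0 < e -> exists d, 0 < d /\ forall s, Rabs (s - t) < d ->
    Cmod (f s - f t - RtoC (s - t) * l) <= e * Rabs (s - t).
Proof.
  assert (Hn : forall (s : R) (a b c : C),
     norm (V := C_R_NormedModule) (minus (minus a b) (scal s c)) = Cmod (a - b - RtoC s * c)).
  { intros s a b c. rewrite Cmod_norm. apply f_equal.
    unfold RtoC, minus, plus, opp, scal, Cminus, Cplus, Copp, Cmult; simpl.
    unfold prod_plus, prod_opp, prod_scal, scal; simpl. unfold mult, plus, opp; simpl.
    apply injective_projections; simpl; ring. }
  split.
  - intros [_ H] e He. destruct (H t (fun P HP => HP) (mkposreal e He)) as [d Hd].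
    exists d. split; [apply cond_pos|]. intros s Hs. rewrite <- Hn. exact (Hd s Hs).
  - intros H. split.
    + apply (is_linear_scal_l (V := C_R_NormedModule)).
    + intros x Hx e. apply (is_filter_lim_locally_unique (V := R_NormedModule)) in Hx. subst x.
      destruct (H e (cond_pos e)) as (d & Hd & Hs). exists (mkposreal d Hd).
      intros s Hs'. specialize (Hs s Hs'). rewrite <- Hn in Hs. exact Hs.
Qed.

Lemma cderiv_RtoC (f : R -> R) (t l : R) :
  is_derive f t l -> cderiv (fun s => RtoC (f s)) t (RtoC l).
Proof.
  intros [_ Hf]. apply cderiv_iff. intros e He.
  destruct (Hf t (fun P HP => HP) (mkposreal e He)) as [d Hd].
  exists d. split; [apply cond_pos|]. intros s Hs. specialize (Hd s Hs).
  rewrite <- !RtoC_minus, <- RtoC_mult, <- RtoC_minus, Cmod_R. exact Hd.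
Qed.

(** * Complex differentiability *)

Definition cdiff (f : C -> C) (z l : C) : Prop :=
  forall e, 0 < e -> exists d, 0 < d /\ forall w, Cmod (w - z) < d ->
    Cmod (f w - f z - (w - z) * l) <= e * Cmod (w - z).

Lemma is_derive_cdiff (f : C -> C) (z l : C) :
  is_derive (K := C_AbsRing) (V := C_NormedModule) f z l <-> cdiff f z l.
Proof.
  split.
  - intros [_ H] e He. destruct (H z (fun P HP => HP) (mkposreal e He)) as [d Hd].
    exists d. split; [apply cond_pos|]. intros s Hs. specialize (Hd s Hs). exact Hd.
  - intros H. split.
    + apply (is_linear_scal_l (V := C_NormedModule)).
    + intros x Hx e. apply (is_filter_lim_locally_unique (V := AbsRing_NormedModule C_AbsRing)) in Hx.
      subst x.
      destruct (H e (cond_pos e)) as (d & Hd & Hs). exists (mkposreal d Hd).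
      intros s Hs'. apply Hs, Hs'.
Qed.

Lemma Cmod_minus_sym (a b : C) : Cmod (a - b) = Cmod (b - a).
Proof. rewrite <- Cmod_opp. f_equal. ring. Qed.

Lemma Cmod_triangle_minus (a b c : C) : Cmod (a - c) <= Cmod (a - b) + Cmod (b - c).
Proof. replace (a - c)%C with ((a - b) + (b - c))%C by ring. apply Cmod_triangle. Qed.

Lemma Cmod_le_add (a b : C) : Cmod a <= Cmod b + Cmod (a - b).
Proof. replace a with (b + (a - b))%C at 1 by ring. apply Cmod_triangle. Qed.

Lemma Cmod_minus_le (a b : C) : Cmod (a - b) <= Cmod a + Cmod b.
Proof. rewrite <- (Cmod_opp b). apply Cmod_triangle. Qed.

(** The standard way to produce derivatives here: affine maps, inverses, primitives and Cauchy
    integrals all come with an explicit second-order remainder. [K] may have any sign, whence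
    [Rabs K + 1] in the choice of radius. *)
Lemma cdiff_of_quadratic (f : C -> C) (z l : C) (K d0 : R) : 0 < d0 ->
  (forall w, Cmod (w - z) < d0 ->
    Cmod (f w - f z - (w - z) * l) <= K * Cmod (w - z) ^ 2) ->
  cdiff f z l.
Proof.
  intros Hd0 H e He. pose proof (Rabs_pos K) as HK.
  exists (Rmin d0 (e / (Rabs K + 1))). split.
  { apply Rmin_pos; [assumption|apply Rdiv_lt_0_compat; lra]. }
  intros w Hw. pose proof (Cmod_ge_0 (w - z)) as Hp.
  eapply Rle_trans. { apply H. eapply Rlt_le_trans; [exact Hw|apply Rmin_l]. }
  assert (Hw2 : Cmod (w - z) * (Rabs K + 1) <= e).
  { apply Rle_div_r; [lra|]. left. eapply Rlt_le_trans; [exact Hw|apply Rmin_r]. }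
  pose proof (Rle_abs K).
  assert (K * Cmod (w - z) <= e).
  { eapply Rle_trans; [|exact Hw2]. rewrite (Rmult_comm (Cmod _)).
    apply Rmult_le_compat_r; lra. }
  simpl. rewrite Rmult_1_r, <- Rmult_assoc. apply Rmult_le_compat_r; lra.
Qed.

Lemma cdiff_lipschitz (f : C -> C) (z l : C) : cdiff f z l ->
  exists d, 0 < d /\ forall w, Cmod (w - z) < d ->
    Cmod (f w - f z) <= (Cmod l + 1) * Cmod (w - z).
Proof.
  intros H. destruct (H 1 Rlt_0_1) as (d & Hd & Hw). exists d; split; [assumption|].
  intros w Hwd. specialize (Hw w Hwd).
  replace (f w - f z)%C with ((w - z) * l + (f w - f z - (w - z) * l))%C by ring.
  eapply Rle_trans; [apply Cmod_triangle|]. rewrite Cmod_mult. lra.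
Qed.

Lemma cdiff_eps_delta (f : C -> C) (z l : C) : cdiff f z l ->
  forall e, 0 < e -> exists d, 0 < d /\ forall w, Cmod (w - z) < d -> Cmod (f w - f z) < e.
Proof.
  intros H e He. destruct (cdiff_lipschitz _ _ _ H) as (d & Hd & Hw).
  pose proof (Cmod_ge_0 l).
  exists (Rmin d (e / (Cmod l + 1))). split.
  { apply Rmin_pos; [assumption|apply Rdiv_lt_0_compat; lra]. }
  intros w Hwd. eapply Rle_lt_trans.
  { apply Hw. eapply Rlt_le_trans; [exact Hwd|apply Rmin_l]. }
  rewrite Rmult_comm. apply Rlt_div_r; [lra|].
  eapply Rlt_le_trans; [exact Hwd|apply Rmin_r].
Qed.

Lemma cdiff_mult (f h : C -> C) (z l m : C) :
  cdiff f z l -> cdiff h z m -> cdiff (fun w => f w * h w)%C z (l * h z + f z * m)%C.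
Proof.
  intros Hf Hh e He.
  destruct (cdiff_lipschitz _ _ _ Hf) as (d1 & Hd1 & H1).
  destruct (cdiff_eps_delta _ _ _ Hh (e / 3 / (Cmod l + 1))) as (d2 & Hd2 & H2).
  { pose proof (Cmod_ge_0 l). apply Rdiv_lt_0_compat; lra. }
  destruct (Hf (e / 3 / (Cmod (h z) + 1))) as (d3 & Hd3 & H3).
  { pose proof (Cmod_ge_0 (h z)). apply Rdiv_lt_0_compat; lra. }
  destruct (Hh (e / 3 / (Cmod (f z) + 1))) as (d4 & Hd4 & H4).
  { pose proof (Cmod_ge_0 (f z)). apply Rdiv_lt_0_compat; lra. }
  exists (Rmin (Rmin d1 d2) (Rmin d3 d4)). split; [repeat apply Rmin_pos; assumption|].
  intros w Hw.
  assert (Hw1 : Cmod (w - z) < Rmin d1 d2) by (eapply Rlt_le_trans; [exact Hw|apply Rmin_l]).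
  assert (Hw2 : Cmod (w - z) < Rmin d3 d4) by (eapply Rlt_le_trans; [exact Hw|apply Rmin_r]).
  specialize (H1 w ltac:(eapply Rlt_le_trans; [exact Hw1|apply Rmin_l])).
  specialize (H2 w ltac:(eapply Rlt_le_trans; [exact Hw1|apply Rmin_r])).
  specialize (H3 w ltac:(eapply Rlt_le_trans; [exact Hw2|apply Rmin_l])).
  specialize (H4 w ltac:(eapply Rlt_le_trans; [exact Hw2|apply Rmin_r])).
  (* Remainder of [f] times [h z], [f z] times remainder of [h], and the product of the two
     increments; each part is allotted a third of [e]. *)
  replace (f w * h w - f z * h z - (w - z) * (l * h z + f z * m))%C with
    ((f w - f z - (w - z) * l) * h z + f z * (h w - h z - (w - z) * m)
     + (f w - f z) * (h w - h z))%C by ring.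
  assert (Haux : forall A B x, 0 <= A -> 0 <= B -> 0 <= x ->
     B <= e / 3 / (A + 1) * x -> B * A <= e / 3 * x).
  { intros A B x HA HB Hx HBA.
    apply Rle_trans with (B * (A + 1)); [apply Rmult_le_compat_l; lra|].
    apply Rle_trans with (e / 3 / (A + 1) * x * (A + 1)); [apply Rmult_le_compat_r; lra|].
    right. field. lra. }
  pose proof (Cmod_ge_0 (w - z)) as Hp.
  eapply Rle_trans; [apply Cmod_triangle|].
  eapply Rle_trans; [apply Rplus_le_compat_r, Cmod_triangle|].
  rewrite !Cmod_mult.
  pose proof (Haux _ _ _ (Cmod_ge_0 (h z)) (Cmod_ge_0 _) Hp H3).
  pose proof (Haux _ _ _ (Cmod_ge_0 (f z)) (Cmod_ge_0 _) Hp H4).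
  assert (Cmod (f w - f z) * Cmod (h w - h z) <= e / 3 * Cmod (w - z)).
  { eapply Rle_trans.
    { apply Rmult_le_compat; [apply Cmod_ge_0|apply Cmod_ge_0|exact H1|left; exact H2]. }
    right. field. pose proof (Cmod_ge_0 l). lra. }
  lra.
Qed.

Lemma cdiff_inv_shift (z0 z : C) : z <> z0 ->
  cdiff (fun w => / (w - z0))%C z (- / ((z - z0) * (z - z0)))%C.
Proof.
  intros Hz.
  assert (Hz' : (z - z0)%C <> 0).
  { intros H. apply Hz. replace z with ((z - z0) + z0)%C by ring. rewrite H. ring. }
  assert (Hm : 0 < Cmod (z - z0)) by (apply Cmod_gt_0; exact Hz').
  (* The remainder is exactly [(w - z) ^ 2 / ((w - z0) * (z - z0) ^ 2)]. Staying within half the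
     distance to the pole keeps [w - z0] at least that half in modulus, which gives the factor 2. *)
  apply cdiff_of_quadratic with (K := 2 / Cmod (z - z0) ^ 3) (d0 := Cmod (z - z0) / 2); [lra|].
  intros w Hw.
  assert (Hwm : Cmod (z - z0) / 2 <= Cmod (w - z0)).
  { pose proof (Cmod_le_add (z - z0) (w - z0)) as H.
    replace (z - z0 - (w - z0))%C with (z - w)%C in H by ring.
    rewrite (Cmod_minus_sym z w) in H. lra. }
  assert (Hw' : (w - z0)%C <> 0) by (apply Cmod_gt_0; lra).
  replace (/ (w - z0) - / (z - z0) - (w - z) * - / ((z - z0) * (z - z0)))%C
    with ((w - z) * (w - z) * / ((w - z0) * ((z - z0) * (z - z0))))%C
    by (field; split; assumption).
  rewrite !Cmod_mult, Cmod_inv, !Cmod_mult.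
  2:{ repeat apply Cmult_neq_0; assumption. }
  replace (Cmod (w - z) * Cmod (w - z)) with (Cmod (w - z) ^ 2) by ring.
  rewrite (Rmult_comm (2 / _)). apply Rmult_le_compat_l; [apply pow2_ge_0|].
  replace (2 / Cmod (z - z0) ^ 3) with
     (/ (Cmod (z - z0) / 2 * (Cmod (z - z0) * Cmod (z - z0)))) by (field; lra).
  apply Rinv_le_contravar.
  - repeat apply Rmult_lt_0_compat; lra.
  - apply Rmult_le_compat_r; [|assumption]. left. apply Rmult_lt_0_compat; lra.
Qed.

Lemma ccont_comp_diff (f : C -> C) (p : R -> C) (t : R) (l : C) :
  ccont p t -> cdiff f (p t) l -> ccont (fun s => f (p s)) t.
Proof.
  rewrite !ccont_iff. intros Hp Hf e He.
  destruct (cdiff_eps_delta _ _ _ Hf e He) as (d & Hd & H).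
  destruct (Hp d Hd) as (d' & Hd' & H'). exists d'; split; [assumption|].
  intros s Hs. apply H, H', Hs.
Qed.

Lemma ccont_inv (p : R -> C) (t : R) : ccont p t -> p t <> 0 -> ccont (fun s => / p s)%C t.
Proof.
  intros Hp Hn.
  apply (continuous_ext (fun s => / (p s - 0))%C).
  { intros s. f_equal. ring. }
  exact (ccont_comp_diff (fun w => / (w - 0))%C p t _ Hp (cdiff_inv_shift 0 _ Hn)).
Qed.

Lemma cderiv_ccont (f : R -> C) (t : R) (l : C) : cderiv f t l -> ccont f t.
Proof. intros H. apply (ex_derive_continuous (V := C_R_NormedModule)). exists l. exact H. Qed.

Lemma cderiv_chain (f : C -> C) (p : R -> C) (t : R) (l m : C) :
  cdiff f (p t) l -> cderiv p t m -> cderiv (fun s => f (p s)) t (m * l)%C.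
Proof.
  intros Hf Hp. pose proof (cderiv_ccont _ _ _ Hp) as Hc.
  rewrite cderiv_iff in Hp |- *. rewrite ccont_iff in Hc. intros e He.
  pose proof (Cmod_ge_0 l) as Hl0. pose proof (Cmod_ge_0 m) as Hm0.
  set (e2 := e / 2 / (Cmod l + 1)).
  assert (He2 : 0 < e2) by (unfold e2; apply Rdiv_lt_0_compat; lra).
  destruct (Hf (e / 2 / (Cmod m + 1))) as (d1 & Hd1 & H1).
  { apply Rdiv_lt_0_compat; lra. }
  destruct (Hp e2 He2) as (d2 & Hd2 & H2).
  destruct (Hp 1 Rlt_0_1) as (d3 & Hd3 & H3).
  destruct (Hc d1 Hd1) as (d4 & Hd4 & H4).
  exists (Rmin d2 (Rmin d3 d4)). split; [repeat apply Rmin_pos; assumption|].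
  intros s Hs.
  assert (Hs2 : Rabs (s - t) < Rmin d3 d4) by (eapply Rlt_le_trans; [exact Hs|apply Rmin_r]).
  specialize (H2 s ltac:(eapply Rlt_le_trans; [exact Hs|apply Rmin_l])).
  specialize (H3 s ltac:(eapply Rlt_le_trans; [exact Hs2|apply Rmin_l])).
  specialize (H4 s ltac:(eapply Rlt_le_trans; [exact Hs2|apply Rmin_r])).
  specialize (H1 _ H4).
  (* The outer remainder is controlled through [|p s - p t| <= (|m| + 1) |s - t|], the inner one is
     multiplied by [l]; each takes half of [e]. *)
  replace (f (p s) - f (p t) - RtoC (s - t) * (m * l))%C with
    ((f (p s) - f (p t) - (p s - p t) * l) + (p s - p t - RtoC (s - t) * m) * l)%C by ring.
  eapply Rle_trans; [apply Cmod_triangle|]. rewrite Cmod_mult.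
  pose proof (Rabs_pos (s - t)) as Hst.
  assert (Hps : Cmod (p s - p t) <= (Cmod m + 1) * Rabs (s - t)).
  { replace (p s - p t)%C with (RtoC (s - t) * m + (p s - p t - RtoC (s - t) * m))%C by ring.
    eapply Rle_trans; [apply Cmod_triangle|]. rewrite Cmod_mult, Cmod_R. lra. }
  assert (A1 : Cmod (f (p s) - f (p t) - (p s - p t) * l) <= e / 2 * Rabs (s - t)).
  { eapply Rle_trans; [exact H1|].
    eapply Rle_trans; [apply Rmult_le_compat_l; [|exact Hps]|].
    - left. apply Rdiv_lt_0_compat; lra.
    - right. field. lra. }
  assert (A2 : Cmod (p s - p t - RtoC (s - t) * m) * Cmod l <= e / 2 * Rabs (s - t)).
  { apply Rle_trans with (e2 * Rabs (s - t) * (Cmod l + 1)).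
    - apply Rmult_le_compat; [apply Cmod_ge_0|apply Cmod_ge_0|exact H2|lra].
    - unfold e2. right. field. lra. }
  lra.
Qed.

(** * Integrals of complex-valued functions *)

Definition is_CInt (f : R -> C) (a b : R) (l : C) : Prop :=
  is_RInt (V := C_R_NormedModule) f a b l.

Definition CInt (f : R -> C) (a b : R) : C := RInt (V := C_R_CompleteNormedModule) f a b.

Lemma CInt_correct (f : R -> C) (a b : R) : a <= b ->
  (forall t, a <= t <= b -> ccont f t) -> is_CInt f a b (CInt f a b).
Proof.
  intros Hab H. apply (RInt_correct (V := C_R_CompleteNormedModule)).
  apply (ex_RInt_continuous (V := C_R_CompleteNormedModule)).
  intros t. rewrite Rmin_left, Rmax_right by assumption. apply H.
Qed.

Lemma CInt_unique (f : R -> C) (a b : R) (l : C) : is_CInt f a b l -> CInt f a b = l.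
Proof. apply (is_RInt_unique (V := C_R_CompleteNormedModule)). Qed.

Lemma is_CInt_plus (f h : R -> C) (a b : R) (l m : C) :
  is_CInt f a b l -> is_CInt h a b m -> is_CInt (fun t => f t + h t)%C a b (l + m)%C.
Proof. apply (is_RInt_plus (V := C_R_NormedModule)). Qed.

Lemma is_CInt_minus (f h : R -> C) (a b : R) (l m : C) :
  is_CInt f a b l -> is_CInt h a b m -> is_CInt (fun t => f t - h t)%C a b (l - m)%C.
Proof. apply (is_RInt_minus (V := C_R_NormedModule)). Qed.

Lemma is_CInt_ext (f h : R -> C) (a b : R) (l : C) : a <= b ->
  (forall t, a <= t <= b -> f t = h t) -> is_CInt f a b l -> is_CInt h a b l.
Proof.
  intros Hab H. apply (is_RInt_ext (V := C_R_NormedModule)).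
  intros t. rewrite Rmin_left, Rmax_right by assumption. intros Ht. apply H. lra.
Qed.

Lemma CInt_ext (f h : R -> C) (a b : R) : a <= b ->
  (forall t, a <= t <= b -> f t = h t) -> CInt f a b = CInt h a b.
Proof.
  intros Hab H. apply (RInt_ext (V := C_R_CompleteNormedModule)).
  intros t. rewrite Rmin_left, Rmax_right by assumption. intros Ht. apply H. lra.
Qed.

(** The integral is linear over real scalars only, so a complex factor is handled on the two
    components, where it acts as a real linear combination. *)
Lemma is_CInt_mult (c : C) (f : R -> C) (a b : R) (l : C) :
  is_CInt f a b l -> is_CInt (fun t => c * f t)%C a b (c * l)%C.
Proof.
  intros H.
  pose proof (is_RInt_fct_extend_fst (U := R_NormedModule) (V := R_NormedModule) _ _ _ _ H) as H1.
  pose proof (is_RInt_fct_extend_snd (U := R_NormedModule) (V := R_NormedModule) _ _ _ _ H) as H2.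
  apply (is_RInt_fct_extend_pair (U := R_NormedModule) (V := R_NormedModule)).
  - apply (is_RInt_minus (V := R_NormedModule)); apply (is_RInt_scal (V := R_NormedModule)); assumption.
  - apply (is_RInt_plus (V := R_NormedModule)); apply (is_RInt_scal (V := R_NormedModule)); assumption.
Qed.

Lemma is_CInt_bound (f : R -> C) (a b M : R) (l : C) : a <= b ->
  (forall t, a <= t <= b -> Cmod (f t) <= M) -> is_CInt f a b l -> Cmod l <= (b - a) * M.
Proof.
  intros Hab H Hl. rewrite Cmod_norm.
  apply (norm_RInt_le_const (V := C_R_NormedModule) f a b l M Hab); [|exact Hl].
  intros t Ht. specialize (H t Ht). rewrite Cmod_norm in H. exact H.
Qed.

Lemma is_CInt_deriv (F f : R -> C) (a b : R) : a <= b ->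
  (forall t, a <= t <= b -> cderiv F t (f t)) ->
  (forall t, a <= t <= b -> ccont f t) -> is_CInt f a b (F b - F a)%C.
Proof.
  intros Hab HF Hf. apply (is_RInt_derive (V := C_R_CompleteNormedModule));
  intros t; rewrite Rmin_left, Rmax_right by assumption; [apply HF|apply Hf].
Qed.

Lemma CInt_Chasles (f : R -> C) (a b c : R) : a <= b <= c ->
  (forall t, a <= t <= c -> ccont f t) -> (CInt f a b + CInt f b c)%C = CInt f a c.
Proof.
  intros [Hab Hbc] H. apply (RInt_Chasles (V := C_R_CompleteNormedModule));
  apply (ex_RInt_continuous (V := C_R_CompleteNormedModule));
  intros t; rewrite Rmin_left, Rmax_right by assumption; intros Ht; apply H; lra.
Qed.

(** * The unit circle *)

Definition circ (t : R) : C := (cos (2 * PI * t), sin (2 * PI * t)).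
Definition twopii : C := (0, 2 * PI).

Lemma Cmod_circ (t : R) : Cmod (circ t) = 1.
Proof.
  unfold Cmod, circ; simpl. transitivity (sqrt 1); [f_equal|apply sqrt_1].
  pose proof (sin2_cos2 (2 * PI * t)) as H. unfold Rsqr in H. lra.
Qed.

Lemma circ_1 : circ 1 = circ 0.
Proof.
  unfold circ. rewrite Rmult_1_r, Rmult_0_r, cos_0, sin_0, cos_2PI, sin_2PI. reflexivity.
Qed.

Lemma twopii_neq_0 : twopii <> 0.
Proof.
  intros H. apply (f_equal snd) in H. simpl in H. pose proof PI_RGT_0. lra.
Qed.

Lemma cderiv_circ (t : R) : cderiv circ t (circ t * twopii)%C.
Proof.
  apply (cderiv_ext (fun s => RtoC (cos (2 * PI * s)) + RtoC (sin (2 * PI * s)) * Ci)%C circ t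
    (RtoC (- sin (2 * PI * t) * (2 * PI)) + RtoC (cos (2 * PI * t) * (2 * PI)) * Ci)%C).
  { intros s. unfold circ. apply injective_projections; simpl; ring. }
  { unfold circ, twopii. apply injective_projections; simpl; ring. }
  apply cderiv_plus.
  - apply cderiv_RtoC. auto_derive; [trivial|ring].
  - apply (cderiv_chain (fun w => w * Ci)%C (fun s => RtoC (sin (2 * PI * s))) t Ci).
    + apply cdiff_of_quadratic with (K := 0) (d0 := 1); [lra|]. intros w _.
      match goal with |- Cmod ?x <= _ => replace x with (RtoC 0) by ring end.
      rewrite Cmod_0. lra.
    + apply cderiv_RtoC. auto_derive; [trivial|ring].
Qed.

Lemma cdiff_affine (a b z : C) : cdiff (fun w => a + b * w)%C z b.
Proof.
  apply cdiff_of_quadratic with (K := 0) (d0 := 1); [lra|]. intros w _.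
  match goal with |- Cmod ?x <= _ => replace x with (RtoC 0) by ring end.
  rewrite Cmod_0. lra.
Qed.

Lemma cderiv_affine (a b : C) (s : R) : cderiv (fun s => a + b * RtoC s)%C s b.
Proof.
  apply (cderiv_ext (fun s => a + b * RtoC s)%C _ s (RtoC 1 * b)%C).
  { reflexivity. } { ring. }
  apply (cderiv_chain (fun w => a + b * w)%C); [apply cdiff_affine|].
  apply cderiv_RtoC. auto_derive; [trivial|ring].
Qed.

Lemma ccont_circ (t : R) : ccont circ t.
Proof. apply (cderiv_ccont _ _ _ (cderiv_circ t)). Qed.

(** The speed of [circ] is constantly [Cmod twopii], so integrating the derivative suffices. *)
Lemma circ_lipschitz (s t : R) : Cmod (circ s - circ t) <= Cmod twopii * Rabs (s - t).
Proof.
  assert (H : forall s t, t <= s -> Cmod (circ s - circ t) <= Cmod twopii * Rabs (s - t)).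
  { clear s t. intros s t Hst. rewrite Rabs_pos_eq, Rmult_comm by lra.
    apply (is_CInt_bound (fun u => circ u * twopii)%C); [assumption| |].
    - intros u _. rewrite Cmod_mult, Cmod_circ. lra.
    - apply is_CInt_deriv; [assumption| |]; intros u _.
      + apply cderiv_circ.
      + apply ccont_mult; [apply ccont_circ|apply ccont_const]. }
  destruct (Rle_dec t s) as [Hs|Hs]; [apply H; assumption|].
  rewrite Cmod_minus_sym, Rabs_minus_sym. apply H. lra.
Qed.

(** * Goursat's lemma on circular homotopies *)

(** [G] is a primitive of the affine approximation of [h] at [w0], whose integral along the path is
    therefore the exact increment of [G]. What remains is the linearisation error, at most [eta] in
    size, against a speed of at most [M]. *)
Lemma path_integral_linearised (h : C -> C) (w0 l : C) (p dp : R -> C) (a b eta M : R) :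
  a <= b ->
  (forall t, a <= t <= b -> cderiv p t (dp t)) ->
  (forall t, a <= t <= b -> ccont dp t) ->
  (forall t, a <= t <= b -> ccont (fun t => h (p t)) t) ->
  (forall t, a <= t <= b -> Cmod (dp t) <= M) ->
  (forall t, a <= t <= b -> Cmod (h (p t) - h w0 - (p t - w0) * l) <= eta) ->
  let G := fun w : C => (h w0 * w + l / 2 * ((w - w0) * (w - w0)))%C in
  Cmod (CInt (fun t => h (p t) * dp t)%C a b - (G (p b) - G (p a))) <= (b - a) * (eta * M).
Proof.
  intros Hab Hp Hdp Hh HM Heta G.
  assert (HG : forall w, cdiff G w (h w0 + (w - w0) * l)%C).
  { intros z. apply cdiff_of_quadratic with (K := Cmod (l / 2)) (d0 := 1); [lra|]. intros w _.
    replace (G w - G z - (w - z) * (h w0 + (z - w0) * l))%C with (l / 2 * ((w - z) * (w - z)))%C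
      by (unfold G; field).
    rewrite !Cmod_mult. right. ring. }
  assert (Hpc : forall t, a <= t <= b -> ccont p t).
  { intros t Ht. apply (cderiv_ccont _ _ _ (Hp t Ht)). }
  assert (I1 : is_CInt (fun t => dp t * (h w0 + (p t - w0) * l))%C a b (G (p b) - G (p a))%C).
  { apply (is_CInt_deriv (fun t => G (p t))); [assumption| |]; intros t Ht.
    - apply (cderiv_chain G p t _ _ (HG _)). apply Hp, Ht.
    - apply ccont_mult; [apply Hdp, Ht|]. apply ccont_plus; [apply ccont_const|].
      apply ccont_mult; [|apply ccont_const]. apply ccont_minus; [apply Hpc, Ht|apply ccont_const]. }
  assert (I2 : is_CInt (fun t => h (p t) * dp t)%C a b (CInt (fun t => h (p t) * dp t)%C a b)).
  { apply CInt_correct; [assumption|]. intros t Ht. apply ccont_mult; [apply Hh, Ht|apply Hdp, Ht]. }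
  apply (is_CInt_bound _ a b (eta * M) _ Hab) with (2 := is_CInt_minus _ _ _ _ _ _ I2 I1).
  intros t Ht.
  replace (h (p t) * dp t - dp t * (h w0 + (p t - w0) * l))%C
    with ((h (p t) - h w0 - (p t - w0) * l) * dp t)%C by ring.
  rewrite Cmod_mult. apply Rmult_le_compat; try apply Cmod_ge_0; [apply Heta, Ht|apply HM, Ht].
Qed.

Section Goursat.
Variables (h : C -> C) (A0 A1 B0 B1 : C).

(** A family of circles whose centre moves from [A0] to [A0 + A1] and whose radius moves from [B0]
    to [B0 + B1]. Being affine in [s], it has explicit partial derivatives. *)
Let Phi (s t : R) : C := (A0 + A1 * RtoC s + (B0 + B1 * RtoC s) * circ t)%C.

Hypothesis h_diff : forall s t, 0 <= s <= 1 -> 0 <= t <= 1 -> exists l, cdiff h (Phi s t) l.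

Let Phis (s t : R) : C := (A1 + B1 * circ t)%C.
Let Phit (s t : R) : C := ((B0 + B1 * RtoC s) * (circ t * twopii))%C.

Lemma cderiv_Phi_s (s t : R) : cderiv (fun s => Phi s t) s (Phis s t).
Proof using.
  apply (cderiv_ext (fun s => (A0 + B0 * circ t) + (A1 + B1 * circ t) * RtoC s)%C _ s
    (A1 + B1 * circ t)%C).
  - intros u. unfold Phi. ring.
  - reflexivity.
  - apply cderiv_affine.
Qed.

Lemma cderiv_Phi_t (s t : R) : cderiv (fun t => Phi s t) t (Phit s t).
Proof using.
  apply (cderiv_ext (fun t => Phi s t) _ t (circ t * twopii * (B0 + B1 * RtoC s))%C).
  - reflexivity.
  - unfold Phit. ring.
  - apply (cderiv_chain (fun w => A0 + A1 * RtoC s + (B0 + B1 * RtoC s) * w)%C circ);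
      [apply cdiff_affine|apply cderiv_circ].
Qed.

Lemma ccont_Phis (s t : R) : ccont (fun s => Phis s t) s.
Proof using. apply ccont_const. Qed.

Lemma ccont_Phit (s t : R) : ccont (fun t => Phit s t) t.
Proof using.
  unfold Phit. repeat apply ccont_mult; try apply ccont_const. apply ccont_circ.
Qed.

Lemma ccont_h_s (s t : R) : 0 <= s <= 1 -> 0 <= t <= 1 -> ccont (fun s => h (Phi s t)) s.
Proof using h_diff.
  intros Hs Ht. destruct (h_diff s t Hs Ht) as [l Hl].
  apply (ccont_comp_diff h (fun s => Phi s t) s l); [|exact Hl].
  apply (cderiv_ccont _ _ _ (cderiv_Phi_s s t)).
Qed.

Lemma ccont_h_t (s t : R) : 0 <= s <= 1 -> 0 <= t <= 1 -> ccont (fun t => h (Phi s t)) t.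
Proof using h_diff.
  intros Hs Ht. destruct (h_diff s t Hs Ht) as [l Hl].
  apply (ccont_comp_diff h (fun t => Phi s t) t l); [|exact Hl].
  apply (cderiv_ccont _ _ _ (cderiv_Phi_t s t)).
Qed.

(** [S] and [T] integrate [h(w) dw] along the images of horizontal and vertical segments of the
    parameter square; [J] is the integral along the image of the boundary of a subsquare, run
    counterclockwise. *)
Let S (a b t : R) : C := CInt (fun s => h (Phi s t) * Phis s t)%C a b.
Let T (a b s : R) : C := CInt (fun t => h (Phi s t) * Phit s t)%C a b.
Let J (a c L : R) : C :=
  (S a (a + L) c + T c (c + L) (a + L) - S a (a + L) (c + L) - T c (c + L) a)%C.

Lemma S_Chasles (a b c t : R) : 0 <= a -> a <= b <= c -> c <= 1 -> 0 <= t <= 1 ->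
  (S a b t + S b c t)%C = S a c t.
Proof using h_diff.
  intros Ha Hb Hc Ht. apply CInt_Chasles; [assumption|]. intros s Hs.
  apply ccont_mult; [apply ccont_h_s; lra|apply ccont_Phis].
Qed.

Lemma T_Chasles (a b c s : R) : 0 <= a -> a <= b <= c -> c <= 1 -> 0 <= s <= 1 ->
  (T a b s + T b c s)%C = T a c s.
Proof using h_diff.
  intros Ha Hb Hc Ht. apply CInt_Chasles; [assumption|]. intros t Hs.
  apply ccont_mult; [apply ccont_h_t; lra|apply ccont_Phit].
Qed.

(** A common bound for both partial derivatives of [Phi]; the added 1 allows division by it. *)
Let M := Cmod A1 + Cmod B1 + (Cmod B0 + Cmod B1) * Cmod twopii + 1.

Lemma M_pos : 0 < M.
Proof using.
  unfold M. pose proof (Cmod_ge_0 A1). pose proof (Cmod_ge_0 B1). pose proof (Cmod_ge_0 B0).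
  pose proof (Cmod_ge_0 twopii).
  assert (0 <= (Cmod B0 + Cmod B1) * Cmod twopii) by (apply Rmult_le_pos; lra). lra.
Qed.

Lemma Phis_bound (s t : R) : Cmod (Phis s t) <= M.
Proof using.
  unfold Phis. eapply Rle_trans; [apply Cmod_triangle|]. rewrite Cmod_mult, Cmod_circ.
  unfold M. pose proof (Cmod_ge_0 B1). pose proof (Cmod_ge_0 B0). pose proof (Cmod_ge_0 twopii).
  assert (0 <= (Cmod B0 + Cmod B1) * Cmod twopii) by (apply Rmult_le_pos; lra). lra.
Qed.

Lemma radius_bound (s : R) : 0 <= s <= 1 -> Cmod (B0 + B1 * RtoC s) <= Cmod B0 + Cmod B1.
Proof using.
  intros Hs. eapply Rle_trans; [apply Cmod_triangle|]. rewrite Cmod_mult, Cmod_R, Rabs_pos_eq by lra.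
  pose proof (Cmod_ge_0 B1). assert (Cmod B1 * s <= Cmod B1 * 1) by (apply Rmult_le_compat_l; lra). lra.
Qed.

Lemma Phit_bound (s t : R) : 0 <= s <= 1 -> Cmod (Phit s t) <= M.
Proof using.
  intros Hs. unfold Phit. rewrite !Cmod_mult, Cmod_circ, Rmult_1_l.
  pose proof (Cmod_ge_0 A1). pose proof (Cmod_ge_0 B1).
  pose proof (Rmult_le_compat_r _ _ _ (Cmod_ge_0 twopii) (radius_bound s Hs)).
  unfold M. lra.
Qed.

Lemma Phi_lipschitz (s t x y L : R) : 0 <= x <= 1 ->
  Rabs (s - x) <= L -> Rabs (t - y) <= L -> Cmod (Phi s t - Phi x y) <= 2 * M * L.
Proof using.
  intros Hx Hs Ht.
  replace (Phi s t - Phi x y)%C with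
    (RtoC (s - x) * Phis s t + (B0 + B1 * RtoC x) * (circ t - circ y))%C
    by (unfold Phi, Phis; rewrite RtoC_minus; ring).
  eapply Rle_trans; [apply Cmod_triangle|]. rewrite !Cmod_mult, Cmod_R.
  pose proof (Rabs_pos (s - x)). pose proof (Rabs_pos (t - y)).
  assert (Rabs (s - x) * Cmod (Phis s t) <= L * M).
  { apply Rmult_le_compat; [assumption|apply Cmod_ge_0|assumption|apply Phis_bound]. }
  assert (Cmod (B0 + B1 * RtoC x) * Cmod (circ t - circ y) <= M * L).
  { apply Rle_trans with ((Cmod B0 + Cmod B1) * (Cmod twopii * L)).
    - apply Rmult_le_compat; try apply Cmod_ge_0; [apply radius_bound, Hx|].
      eapply Rle_trans; [apply circ_lipschitz|]. apply Rmult_le_compat_l; [apply Cmod_ge_0|assumption].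
    - rewrite <- Rmult_assoc. apply Rmult_le_compat_r; [lra|].
      unfold M. pose proof (Cmod_ge_0 A1). pose proof (Cmod_ge_0 B1). lra. }
  lra.
Qed.

(** Goursat's local estimate: the affine part of [h] at [Phi x y] integrates to zero around the
    boundary, and the error is small compared with the side, over a boundary of length proportional
    to the side. *)
Lemma goursat_local (e x y : R) : 0 < e -> 0 <= x <= 1 -> 0 <= y <= 1 ->
  exists d, 0 < d /\ forall a c L, 0 < L < d ->
    a <= x <= a + L -> c <= y <= c + L ->
    0 <= a -> a + L <= 1 -> 0 <= c -> c + L <= 1 -> Cmod (J a c L) <= e * L ^ 2.
Proof using h_diff.
  intros He Hx Hy. pose proof M_pos as HM.
  destruct (h_diff x y Hx Hy) as [l Hl].
  (* The image of a square of side [L] stays within [2 * M * L] of [w0], so [eta] equals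
     [e * L / (4 * M)]. An edge of parameter length [L] and speed at most [M] then contributes at
     most [e * L ^ 2 / 4]. *)
  destruct (Hl (e / (8 * M ^ 2))) as (d & Hd & Hw).
  { apply Rdiv_lt_0_compat; [assumption|]. apply Rmult_lt_0_compat; [lra|apply pow_lt, HM]. }
  exists (d / (2 * M)). split; [apply Rdiv_lt_0_compat; lra|].
  intros a c L HL Hax Hcy Ha HaL Hc HcL.
  assert (HLd : 2 * M * L < d).
  { destruct HL as [_ HL]. apply Rlt_div_r in HL; lra. }
  set (w0 := Phi x y).
  set (eta := e / (8 * M ^ 2) * (2 * M * L)).
  assert (Hest : forall s t, a <= s <= a + L -> c <= t <= c + L ->
    Cmod (h (Phi s t) - h w0 - (Phi s t - w0) * l) <= eta).
  { intros s t Hs Ht.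
    assert (HP : Cmod (Phi s t - w0) <= 2 * M * L).
    { apply Phi_lipschitz; [assumption| |]; apply Rabs_le; lra. }
    eapply Rle_trans; [apply Hw; unfold w0 in HP; lra|].
    apply Rmult_le_compat_l; [|exact HP].
    left. apply Rdiv_lt_0_compat; [assumption|]. apply Rmult_lt_0_compat; [lra|apply pow_lt, HM]. }
  assert (ES : forall t, c <= t <= c + L -> _) by
   (intros t Ht; exact (path_integral_linearised h w0 l (fun s => Phi s t) (fun s => Phis s t) a (a + L) eta M
     ltac:(lra) (fun s _ => cderiv_Phi_s s t) (fun s _ => ccont_Phis s t)
     (fun s Hs => ccont_h_s s t ltac:(lra) ltac:(lra)) (fun s _ => Phis_bound s t)
     (fun s Hs => Hest s t Hs Ht))).
  assert (ET : forall s, a <= s <= a + L -> _) by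
   (intros s Hs; exact (path_integral_linearised h w0 l (fun t => Phi s t) (fun t => Phit s t) c (c + L) eta M
     ltac:(lra) (fun t _ => cderiv_Phi_t s t) (fun t _ => ccont_Phit s t)
     (fun t Ht => ccont_h_t s t ltac:(lra) ltac:(lra)) (fun t _ => Phit_bound s t ltac:(lra))
     (fun t Ht => Hest s t Hs Ht))).
  pose proof (ES c ltac:(lra)) as E1. pose proof (ES (c + L) ltac:(lra)) as E2.
  pose proof (ET a ltac:(lra)) as E3. pose proof (ET (a + L) ltac:(lra)) as E4.
  clear ES ET. simpl in E1, E2, E3, E4.
  set (G := fun w : C => (h w0 * w + l / 2 * ((w - w0) * (w - w0)))%C).
  fold (S a (a + L) c) in E1. fold (S a (a + L) (c + L)) in E2.
  fold (T c (c + L) a) in E3. fold (T c (c + L) (a + L)) in E4.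
  change (Cmod (S a (a + L) c - (G (Phi (a + L) c) - G (Phi a c))) <= (a + L - a) * (eta * M)) in E1.
  change (Cmod (S a (a + L) (c + L) - (G (Phi (a + L) (c + L)) - G (Phi a (c + L)))) <= (a + L - a) * (eta * M)) in E2.
  change (Cmod (T c (c + L) a - (G (Phi a (c + L)) - G (Phi a c))) <= (c + L - c) * (eta * M)) in E3.
  change (Cmod (T c (c + L) (a + L) - (G (Phi (a + L) (c + L)) - G (Phi (a + L) c))) <= (c + L - c) * (eta * M)) in E4.
  unfold J.
  (* The increments of [G] cancel around the four corners, leaving only the four edge errors. *)
  replace (S a (a + L) c + T c (c + L) (a + L) - S a (a + L) (c + L) - T c (c + L) a)%C with
   (((S a (a + L) c - (G (Phi (a + L) c) - G (Phi a c)))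
    + (T c (c + L) (a + L) - (G (Phi (a + L) (c + L)) - G (Phi (a + L) c))))
    - (S a (a + L) (c + L) - (G (Phi (a + L) (c + L)) - G (Phi a (c + L))))
    - (T c (c + L) a - (G (Phi a (c + L)) - G (Phi a c))))%C by ring.
  eapply Rle_trans; [apply Cmod_minus_le|].
  eapply Rle_trans; [apply Rplus_le_compat_r, Cmod_minus_le|].
  eapply Rle_trans; [apply Rplus_le_compat_r, Rplus_le_compat_r, Cmod_triangle|].
  replace (e * L ^ 2) with (4 * (L * (eta * M))) by (unfold eta; field; lra).
  replace (a + L - a) with L in * by ring. replace (c + L - c) with L in * by ring.
  lra.
Qed.

(** The bound [e * L ^ 2] scales like area, so it passes from the four quarters to the whole square;
    on the unit square it reads [e], for arbitrary [e]. *)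
Lemma goursat_square : J 0 0 1 = 0.
Proof using h_diff.
  apply Cmod_eq_0. apply Rle_antisym; [|apply Cmod_ge_0].
  apply le_epsilon. intros e He. rewrite Rplus_0_l.
  replace e with (e * 1 ^ 2) by ring.
  (* The bisection ranges over arbitrary squares, so the predicate carries the condition of lying in
     the unit square as premises; the goal is brought to that shape. *)
  revert He. cut (0 < e -> 0 <= 0 -> 0 + 1 <= 1 -> 0 <= 0 -> 0 + 1 <= 1 -> Cmod (J 0 0 1) <= e * 1 ^ 2).
  { intros H He. apply H; lra. }
  intros He.
  apply (cousin_square (fun a c L => 0 <= a -> a + L <= 1 -> 0 <= c -> c + L <= 1 ->
     Cmod (J a c L) <= e * L ^ 2) 0 0 1); [lra| |].
  - intros a c L HL H1 H2 H3 H4 Ha HaL Hc HcL.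
    specialize (H1 ltac:(lra) ltac:(lra) ltac:(lra) ltac:(lra)).
    specialize (H2 ltac:(lra) ltac:(lra) ltac:(lra) ltac:(lra)).
    specialize (H3 ltac:(lra) ltac:(lra) ltac:(lra) ltac:(lra)).
    specialize (H4 ltac:(lra) ltac:(lra) ltac:(lra) ltac:(lra)).
    assert (HJ : J a c L = (J a c (L / 2) + J (a + L / 2) c (L / 2)
      + J a (c + L / 2) (L / 2) + J (a + L / 2) (c + L / 2) (L / 2))%C).
    { unfold J. replace (a + L / 2 + L / 2) with (a + L) by field.
      replace (c + L / 2 + L / 2) with (c + L) by field.
      rewrite <- (S_Chasles a (a + L / 2) (a + L) c) by lra.
      rewrite <- (S_Chasles a (a + L / 2) (a + L) (c + L)) by lra.
      rewrite <- (T_Chasles c (c + L / 2) (c + L) a) by lra.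
      rewrite <- (T_Chasles c (c + L / 2) (c + L) (a + L)) by lra.
      ring. }
    rewrite HJ.
    eapply Rle_trans; [apply Cmod_triangle|].
    eapply Rle_trans; [apply Rplus_le_compat_r, Cmod_triangle|].
    eapply Rle_trans; [apply Rplus_le_compat_r, Rplus_le_compat_r, Cmod_triangle|].
    replace (e * L ^ 2) with (4 * (e * (L / 2) ^ 2)) by field. lra.
  - intros x y Hx Hy. destruct (goursat_local e x y He) as (d & Hd & H); [lra|lra|].
    exists d. split; [assumption|]. intros a c L HL Hax Hcy. apply H; assumption.
Qed.

(** The edges [t = 0] and [t = 1] have the same image because [circ] is closed; they cancel in the
    boundary integral, and the integrals over the initial and final circle must agree. *)
Lemma goursat_circles :
  CInt (fun t => h (A0 + A1 + (B0 + B1) * circ t) * ((B0 + B1) * (circ t * twopii)))%C 0 1 =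
  CInt (fun t => h (A0 + B0 * circ t) * (B0 * (circ t * twopii)))%C 0 1.
Proof using h_diff.
  pose proof goursat_square as H. unfold J in H. rewrite Rplus_0_l in H.
  assert (HS : S 0 1 1 = S 0 1 0).
  { unfold S. apply CInt_ext; [lra|]. intros s _. unfold Phi, Phis. rewrite circ_1. reflexivity. }
  rewrite HS in H.
  assert (HT : T 0 1 1 = T 0 1 0).
  { replace (T 0 1 1) with (S 0 1 0 + T 0 1 1 - S 0 1 0 - T 0 1 0 + T 0 1 0)%C by ring.
    rewrite H. ring. }
  unfold T, Phi, Phit in HT.
  etransitivity; [|etransitivity; [exact HT|]]; apply CInt_ext; try lra; intros t _.
  - rewrite !Cmult_1_r. reflexivity.
  - rewrite !Cmult_0_r, !Cplus_0_r. reflexivity.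
Qed.
End Goursat.

(** * Cauchy's formula and its consequences *)

Lemma analytic_cdiff (f : C -> C) (z : C) : analytic f -> disc z -> cdiff f z (C_derive f z).
Proof.
  intros Hf Hz. apply is_derive_cdiff. exact (C_derive_correct f z 0 (Hf z Hz)).
Qed.

Lemma cdiff_analytic (f : C -> C) : (forall z, disc z -> exists l, cdiff f z l) -> analytic f.
Proof.
  intros H z Hz. destruct (H z Hz) as [l Hl]. exists l. apply is_derive_cdiff, Hl.
Qed.

Lemma cdiff_C_derive (f : C -> C) (z l : C) : cdiff f z l -> C_derive f z = l.
Proof. intros H. apply is_C_derive_unique. apply is_derive_cdiff in H. exact H. Qed.

Lemma ccont_ray (z : C) (t : R) : ccont (fun t => RtoC t * z)%C t.
Proof. apply ccont_mult; [apply ccont_RtoC, continuous_id|apply ccont_const]. Qed.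

Lemma Cmod_ray (z : C) (t : R) : 0 <= t <= 1 -> Cmod (RtoC t * z) <= Cmod z.
Proof.
  intros Ht. rewrite Cmod_mult, Cmod_R, Rabs_pos_eq by lra.
  pose proof (Cmod_ge_0 z). apply Rle_trans with (1 * Cmod z); [apply Rmult_le_compat_r; lra|lra].
Qed.

Lemma Cmod_circle (r t : R) : 0 <= r -> Cmod (RtoC r * circ t) = r.
Proof. intros Hr. rewrite Cmod_mult, Cmod_circ, Cmod_R, Rabs_pos_eq by assumption. ring. Qed.

Lemma ccont_circle (r t : R) : ccont (fun t => RtoC r * circ t)%C t.
Proof. apply ccont_mult; [apply ccont_const|apply ccont_circ]. Qed.

Lemma circle_dist (r t : R) (z : C) : 0 <= r -> r - Cmod z <= Cmod (RtoC r * circ t - z).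
Proof.
  intros Hr. pose proof (Cmod_le_add (RtoC r * circ t) z) as H. rewrite Cmod_circle in H by assumption.
  lra.
Qed.

Lemma circle_neq (r t : R) (z : C) : Cmod z < r -> (RtoC r * circ t - z)%C <> 0.
Proof.
  intros Hz. pose proof (Cmod_ge_0 z). pose proof (circle_dist r t z ltac:(lra)).
  apply Cmod_gt_0. lra.
Qed.

Lemma ccont_analytic (f : C -> C) (p : R -> C) (t : R) :
  analytic f -> ccont p t -> disc (p t) -> ccont (fun s => f (p s)) t.
Proof.
  intros Hf Hp Hd. exact (ccont_comp_diff f p t _ Hp (analytic_cdiff f _ Hf Hd)).
Qed.

Lemma ccont_cauchy_kernel (phi : R -> C) (r t : R) (z : C) : Cmod z < r -> ccont phi t ->
  ccont (fun t => phi t * / (RtoC r * circ t - z))%C t.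
Proof.
  intros Hz Hphi. apply ccont_mult; [assumption|]. apply ccont_inv.
  - apply ccont_minus; [apply ccont_circle|apply ccont_const].
  - apply circle_neq, Hz.
Qed.

(* The homotopy [(1 - s) z + ((1 - s) e + s r) circ t] deforms the circle of
   radius [e] about [z] into the circle of radius [r] about [0] without meeting [z]. *)
Lemma cauchy_formula (f : C -> C) (r : R) (z : C) : analytic f -> Cmod z < r < 1 ->
  is_CInt (fun t => f (RtoC r * circ t) * (RtoC r * circ t) * / (RtoC r * circ t - z))%C 0 1 (f z).
Proof.
  intros Hf Hz. pose proof (Cmod_ge_0 z) as Hz0.
  (* On this circle [w dt] equals [dw / (2 pi i)], which is why no constant stands in front of the
     integral. *)
  set (F := (fun t => f (RtoC r * circ t) * (RtoC r * circ t) * / (RtoC r * circ t - z))%C).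
  assert (HF : is_CInt F 0 1 (CInt F 0 1)).
  { apply CInt_correct; [lra|]. intros t _.
    apply (ccont_cauchy_kernel (fun t => f (RtoC r * circ t) * (RtoC r * circ t))%C); [lra|].
    apply ccont_mult; [|apply ccont_circle].
    apply (ccont_analytic f (fun t => RtoC r * circ t)%C); [assumption|apply ccont_circle|].
    unfold disc. rewrite Cmod_circle; lra. }
  replace (f z) with (CInt F 0 1); [exact HF|].
  (* After deformation to a circle about [z] the Cauchy kernel cancels and the integral becomes the
     mean of [f] over that circle, which tends to [f z] as [e] shrinks. *)
  assert (Hmain : forall e, 0 < e < r - Cmod z ->
    is_CInt (fun t => f (z + RtoC e * circ t))%C 0 1 (CInt F 0 1)).
  { intros e He.
    assert (Hc : forall t, ccont (fun t => f (z + RtoC e * circ t))%C t).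
    { intros t. apply (ccont_analytic f (fun t => z + RtoC e * circ t)%C); [assumption| |].
      - apply ccont_plus; [apply ccont_const|apply ccont_circle].
      - unfold disc. eapply Rle_lt_trans; [apply Cmod_triangle|]. rewrite Cmod_circle; lra. }
    pose proof (CInt_correct _ 0 1 Rle_0_1 (fun t _ => Hc t)) as HI.
    replace (CInt F 0 1) with (CInt (fun t => f (z + RtoC e * circ t))%C 0 1); [exact HI|].
    pose proof (goursat_circles (fun w => f w * / (w - z))%C z (- z) (RtoC e) (RtoC (r - e))) as HG.
    apply (f_equal (fun w => / twopii * w)%C) in HG.
    2:{ intros s t Hs _.
      assert (Hrad : (RtoC e + RtoC (r - e) * RtoC s)%C = RtoC ((1 - s) * e + s * r)).
      { rewrite <- RtoC_mult, <- RtoC_plus. f_equal. ring. }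
      rewrite Hrad.
      assert (Hpos : 0 <= (1 - s) * e + s * r).
      { apply Rplus_le_le_0_compat; apply Rmult_le_pos; lra. }
      assert (Hin : disc (z + - z * RtoC s + RtoC ((1 - s) * e + s * r) * circ t)).
      { unfold disc. eapply Rle_lt_trans; [apply Cmod_triangle|].
        rewrite Cmod_circle by assumption.
        replace (z + - z * RtoC s)%C with (RtoC (1 - s) * z)%C by (rewrite RtoC_minus; ring).
        rewrite Cmod_mult, Cmod_R, Rabs_pos_eq by lra.
        apply Rle_lt_trans with r; [|lra].
        replace r with ((1 - s) * r + s * r) at 2 by ring.
        rewrite <- Rplus_assoc. apply Rplus_le_compat_r. rewrite <- Rmult_plus_distr_l.
        apply Rmult_le_compat_l; lra. }
      (* Passing through [z] would give [(1 - s) * e + s * (r - Cmod z) = 0] on taking moduli. Both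
         terms are nonnegative, and one is positive according to the position of [s] relative to
         [1 / 2]. *)
      assert (Hne : (z + - z * RtoC s + RtoC ((1 - s) * e + s * r) * circ t)%C <> z).
      { intros Heq.
        assert (H0 : (RtoC ((1 - s) * e + s * r) * circ t)%C = (z * RtoC s)%C).
        { replace (RtoC ((1 - s) * e + s * r) * circ t)%C with
           ((z + - z * RtoC s + RtoC ((1 - s) * e + s * r) * circ t) - z + z * RtoC s)%C by ring.
          rewrite Heq. ring. }
        apply (f_equal Cmod) in H0. rewrite Cmod_circle in H0 by assumption.
        rewrite Cmod_mult, Cmod_R, Rabs_pos_eq in H0 by lra.
        assert (Hd : (1 - s) * e + s * (r - Cmod z) = 0) by lra.
        assert (0 <= (1 - s) * e) by (apply Rmult_le_pos; lra).
        assert (0 <= s * (r - Cmod z)) by (apply Rmult_le_pos; lra).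
        destruct (Rle_lt_dec s (1 / 2)) as [H'|H'].
        - assert (0 < (1 - s) * e) by (apply Rmult_lt_0_compat; lra). lra.
        - assert (0 < s * (r - Cmod z)) by (apply Rmult_lt_0_compat; lra). lra. }
      eexists. apply (cdiff_mult f (fun w => / (w - z))%C).
      - apply analytic_cdiff; assumption.
      - apply cdiff_inv_shift, Hne. }
    assert (HL : CInt (fun t => f (z + - z + (RtoC e + RtoC (r - e)) * circ t) *
        / (z + - z + (RtoC e + RtoC (r - e)) * circ t - z) *
        ((RtoC e + RtoC (r - e)) * (circ t * twopii)))%C 0 1 = (twopii * CInt F 0 1)%C).
    { apply CInt_unique. apply (is_CInt_ext (fun t => twopii * F t)%C); [lra| |apply is_CInt_mult, HF].
      intros t _. unfold F.
      replace (RtoC e + RtoC (r - e))%C with (RtoC r) by (rewrite <- RtoC_plus; f_equal; ring).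
      replace (z + - z + RtoC r * circ t)%C with (RtoC r * circ t)%C by ring. ring. }
    assert (HR : CInt (fun t => f (z + RtoC e * circ t) *
        / (z + RtoC e * circ t - z) * (RtoC e * (circ t * twopii)))%C 0 1 =
        (twopii * CInt (fun t => f (z + RtoC e * circ t))%C 0 1)%C).
    { apply CInt_unique. apply (is_CInt_ext (fun t => twopii * f (z + RtoC e * circ t))%C);
        [lra| |apply is_CInt_mult, HI].
      intros t _. replace (z + RtoC e * circ t - z)%C with (RtoC e * circ t)%C by ring.
      assert ((RtoC e * circ t)%C <> 0) by (apply Cmod_gt_0; rewrite Cmod_circle; lra).
      field. split; intros H0; rewrite H0 in *; apply H; ring. }
    rewrite HL, HR in HG.
    transitivity (/ twopii * (twopii * CInt (fun t => f (z + RtoC e * circ t))%C 0 1))%C.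
    { field. exact twopii_neq_0. }
    rewrite <- HG. field. exact twopii_neq_0. }
  assert (Hz1 : disc z) by (unfold disc; lra).
  enough (H0 : (CInt F 0 1 - f z)%C = 0).
  { replace (CInt F 0 1) with ((CInt F 0 1 - f z) + f z)%C by ring. rewrite H0. ring. }
  apply Cmod_eq_0. apply Rle_antisym; [|apply Cmod_ge_0].
  apply le_epsilon. intros eta Heta. rewrite Rplus_0_l.
  destruct (cdiff_eps_delta _ _ _ (analytic_cdiff f z Hf Hz1) eta Heta) as (d & Hd & H).
  set (e := Rmin d (r - Cmod z) / 2).
  assert (He : 0 < e < r - Cmod z /\ e < d).
  { unfold e. pose proof (Rmin_l d (r - Cmod z)). pose proof (Rmin_r d (r - Cmod z)).
    assert (0 < Rmin d (r - Cmod z)) by (apply Rmin_pos; lra). lra. }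
  replace eta with ((1 - 0) * eta) by ring.
  refine (is_CInt_bound _ 0 1 eta _ Rle_0_1 _
    (is_CInt_minus _ _ 0 1 _ _ (Hmain e (proj1 He)) _)).
  2:{ replace (f z) with (f z * RtoC 1 - f z * RtoC 0)%C by ring.
      apply (is_CInt_deriv (fun t => f z * RtoC t)%C (fun _ => f z)); [lra| |].
      - intros t _. apply (cderiv_ext (fun t => 0 + f z * RtoC t)%C _ t (f z)).
        + intros s. ring. + reflexivity. + apply cderiv_affine.
      - intros t _. apply ccont_const. }
  intros t _. left. simpl. apply H.
  replace (z + RtoC e * circ t - z)%C with (RtoC e * circ t)%C by ring.
  rewrite Cmod_circle; lra.
Qed.

(** Integrate [1/(q - w) - 1/(q - z) - (w - z)/(q - z)^2 = (w - z)^2 / ((q - w) (q - z)^2)] against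
    [phi]; every denominator factor is at least [r - rho] in modulus. The density is arbitrary, so
    that a limit function not yet known to be analytic can be fed in. *)
Lemma cauchy_transform_quadratic (phi : R -> C) (G : C -> C) (r rho M : R) : 0 <= rho < r ->
  (forall t, 0 <= t <= 1 -> ccont phi t) ->
  (forall t, 0 <= t <= 1 -> Cmod (phi t) <= M) ->
  (forall z, Cmod z <= rho ->
    is_CInt (fun t => phi t * / (RtoC r * circ t - z))%C 0 1 (G z)) ->
  exists D : C -> C, forall z w, Cmod z <= rho -> Cmod w <= rho ->
    Cmod (G w - G z - (w - z) * D z) <= M / (r - rho) ^ 3 * Cmod (w - z) ^ 2.
Proof.
  intros Hr Hphi HM HG.
  set (K := fun (z : C) (t : R) => (phi t * / (RtoC r * circ t - z) * / (RtoC r * circ t - z))%C).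
  exists (fun z => CInt (K z) 0 1). intros z w Hz Hw.
  assert (HK : is_CInt (K z) 0 1 (CInt (K z) 0 1)).
  { apply CInt_correct; [lra|]. intros t Ht. unfold K.
    apply (ccont_cauchy_kernel (fun t => phi t * / (RtoC r * circ t - z))%C); [lra|].
    apply ccont_cauchy_kernel; [lra|apply Hphi, Ht]. }
  replace (M / (r - rho) ^ 3 * Cmod (w - z) ^ 2) with ((1 - 0) * (M / (r - rho) ^ 3 * Cmod (w - z) ^ 2)) by ring.
  refine (is_CInt_bound _ 0 1 _ _ Rle_0_1 _
    (is_CInt_minus _ _ 0 1 _ _ (is_CInt_minus _ _ 0 1 _ _ (HG w Hw) (HG z Hz))
      (is_CInt_mult (w - z)%C _ 0 1 _ HK))).
  intros t Ht. unfold K.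
  assert (Hzn : (RtoC r * circ t - z)%C <> 0) by (apply circle_neq; lra).
  assert (Hwn : (RtoC r * circ t - w)%C <> 0) by (apply circle_neq; lra).
  set (q := (RtoC r * circ t)%C) in *.
  replace (phi t * / (q - w) - phi t * / (q - z) - (w - z) * (phi t * / (q - z) * / (q - z)))%C
    with (phi t * ((w - z) * (w - z)) * / ((q - w) * ((q - z) * (q - z))))%C
    by (field; split; assumption).
  rewrite !Cmod_mult, Cmod_inv, !Cmod_mult by (repeat apply Cmult_neq_0; assumption).
  assert (Hdz : r - rho <= Cmod (q - z)) by (unfold q; pose proof (circle_dist r t z); lra).
  assert (Hdw : r - rho <= Cmod (q - w)) by (unfold q; pose proof (circle_dist r t w); lra).
  assert (Hd3 : (r - rho) ^ 3 <= Cmod (q - w) * (Cmod (q - z) * Cmod (q - z))).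
  { simpl. rewrite Rmult_1_r.
    repeat apply Rmult_le_compat; try assumption; try lra; apply Rmult_le_pos; lra. }
  assert (Hp3 : 0 < (r - rho) ^ 3) by (apply pow_lt; lra).
  pose proof (Rinv_le_contravar _ _ Hp3 Hd3) as Hi.
  pose proof (HM t Ht) as HMt. pose proof (Cmod_ge_0 (phi t)) as H0.
  set (x := Cmod (w - z)) in *.
  assert (Hx : 0 <= x * x) by (apply Rmult_le_pos; apply Cmod_ge_0).
  apply Rle_trans with (M * (x * x) * / (r - rho) ^ 3).
  - apply Rmult_le_compat; [apply Rmult_le_pos; assumption| | |exact Hi].
    + left. apply Rinv_0_lt_compat. lra.
    + apply Rmult_le_compat_r; assumption.
  - right. unfold Rdiv. ring.
Qed.

(** Compactness through [cousin_square]: bounds on four quarters add up to a bound on the square.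
    The predicate looks only at points of the closed disc, since nothing is known about [f]
    elsewhere. *)
Lemma locally_bounded_closed_disc (f : C -> C) (rho : R) :
  (forall z, Cmod z <= rho -> exists d M, 0 < d /\ forall w, Cmod (w - z) < d -> Cmod (f w) <= M) ->
  exists M, 0 <= M /\ forall z, Cmod z <= rho -> Cmod (f z) <= M.
Proof.
  intros H.
  set (P := fun a c L => exists M, 0 <= M /\ forall z : C, a <= fst z <= a + L -> c <= snd z <= c + L ->
    Cmod z <= rho -> Cmod (f z) <= M).
  set (L0 := 2 * (Rabs rho + 1)). pose proof (Rabs_pos rho) as Hr0.
  assert (HP : P (- (Rabs rho + 1)) (- (Rabs rho + 1)) L0).
  { apply cousin_square; [unfold L0; lra| |].
    - intros a c L HL (M1 & P1 & H1) (M2 & P2 & H2) (M3 & P3 & H3) (M4 & P4 & H4).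
      exists (M1 + M2 + M3 + M4). split; [lra|].
      intros z Hz1 Hz2 Hz.
      destruct (Rle_dec (fst z) (a + L / 2)); destruct (Rle_dec (snd z) (c + L / 2)).
      + specialize (H1 z ltac:(lra) ltac:(lra) Hz). lra.
      + specialize (H3 z ltac:(lra) ltac:(lra) Hz). lra.
      + specialize (H2 z ltac:(lra) ltac:(lra) Hz). lra.
      + specialize (H4 z ltac:(lra) ltac:(lra) Hz). lra.
    - intros x y _ _.
      assert (Hbox : forall a c L z, 0 < L -> a <= x <= a + L -> c <= y <= c + L ->
        a <= fst z <= a + L -> c <= snd z <= c + L -> Cmod (z - (x, y)) <= 2 * L).
      { intros a c L z HL H1 H2 H3 H4. eapply Rle_trans; [apply Cmod_2Rmax|].
        apply Rmult_le_compat; [apply sqrt_pos| | |].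
        - eapply Rle_trans; [apply Rabs_pos|apply Rmax_l].
        - rewrite <- (sqrt_square 2) at 2 by lra. apply sqrt_le_1_alt. lra.
        - apply Rmax_lub; simpl; apply Rabs_le; lra. }
      (* A centre outside the closed disc has small squares that miss the disc, where the bound 0
         holds vacuously. *)
      destruct (Rle_lt_dec (Cmod (x, y)) rho) as [Hxy|Hxy].
      + destruct (H (x, y) Hxy) as (d & M & Hd & HM).
        exists (d / 2). split; [lra|]. intros a c L HL Hx Hy. exists (Rabs M).
        split; [apply Rabs_pos|]. intros z H1 H2 _.
        eapply Rle_trans; [|apply Rle_abs]. apply HM.
        eapply Rle_lt_trans; [apply (Hbox a c L z); tauto|]. lra.
      + exists ((Cmod (x, y) - rho) / 2). split; [lra|]. intros a c L HL Hx Hy. exists 0.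
        split; [lra|]. intros z H1 H2 Hz. exfalso.
        pose proof (Hbox a c L z ltac:(lra) Hx Hy H1 H2) as Hb.
        pose proof (Cmod_le_add (x, y) z) as Ht. rewrite Cmod_minus_sym in Ht. lra. }
  destruct HP as (M & HM & Hb). exists M. split; [assumption|].
  intros z Hz.
  pose proof (Rle_trans _ _ _ (Rmax_l _ _) (Rmax_Cmod z)) as H1.
  pose proof (Rle_trans _ _ _ (Rmax_r _ _) (Rmax_Cmod z)) as H2.
  apply Rabs_le_between in H1. apply Rabs_le_between in H2. pose proof (Rle_abs rho).
  apply Hb; [unfold L0; lra|unfold L0; lra|assumption].
Qed.

Lemma analytic_bounded (f : C -> C) (rho : R) : analytic f -> rho < 1 ->
  exists M, 0 <= M /\ forall z, Cmod z <= rho -> Cmod (f z) <= M.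
Proof.
  intros Hf Hr. apply locally_bounded_closed_disc. intros z Hz.
  destruct (cdiff_eps_delta _ _ _ (analytic_cdiff f z Hf ltac:(unfold disc; lra)) 1 Rlt_0_1)
    as (d & Hd & H).
  exists d, (Cmod (f z) + 1). split; [assumption|]. intros w Hw. specialize (H w Hw).
  pose proof (Cmod_le_add (f w) (f z)). lra.
Qed.

Lemma analytic_quadratic (f : C -> C) (rho : R) : analytic f -> 0 <= rho < 1 ->
  exists K, 0 <= K /\ forall z w, Cmod z <= rho -> Cmod w <= rho ->
    Cmod (f w - f z - (w - z) * C_derive f z) <= K * Cmod (w - z) ^ 2.
Proof.
  (* The estimate is taken on the larger disc of radius [rho']: identifying [D z] with the
     derivative needs a full neighbourhood of [z], also when [z] lies on the circle of radius
     [rho]. *)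
  intros Hf Hr. set (rho' := (rho + 1) / 2). set (r := (rho' + 1) / 2).
  assert (Hr' : rho < rho' < r /\ r < 1) by (unfold r, rho'; lra).
  destruct (analytic_bounded f r Hf ltac:(lra)) as (M & HM & Hb).
  destruct (cauchy_transform_quadratic (fun t => f (RtoC r * circ t) * (RtoC r * circ t))%C f
    r rho' M) as [D HD].
  - lra.
  - intros t _. apply ccont_mult; [|apply ccont_circle].
    apply (ccont_analytic f (fun t => RtoC r * circ t)%C); [assumption|apply ccont_circle|].
    unfold disc. rewrite Cmod_circle; lra.
  - intros t _. rewrite Cmod_mult, Cmod_circle by lra.
    specialize (Hb (RtoC r * circ t)%C). rewrite Cmod_circle in Hb by lra. specialize (Hb (Rle_refl r)).
    apply Rle_trans with (M * 1); [|lra]. apply Rmult_le_compat; try lra. apply Cmod_ge_0.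
  - intros z Hz. apply cauchy_formula; [assumption|lra].
  - exists (M / (r - rho') ^ 3). split.
    { apply Rmult_le_pos; [assumption|]. left. apply Rinv_0_lt_compat, pow_lt. lra. }
    intros z w Hz Hw. replace (C_derive f z) with (D z); [apply HD; lra|].
    symmetry. apply cdiff_C_derive.
    apply cdiff_of_quadratic with (K := M / (r - rho') ^ 3) (d0 := rho' - rho); [lra|].
    intros u Hu. apply HD; [lra|]. pose proof (Cmod_le_add u z). lra.
Qed.

(* Exchanging the two points in the quadratic estimate and adding the results
   compares the derivatives. *)
Lemma C_derive_lipschitz (f : C -> C) (rho : R) : analytic f -> 0 <= rho < 1 ->
  exists K, 0 <= K /\ forall z w, Cmod z <= rho -> Cmod w <= rho ->
    Cmod (C_derive f w - C_derive f z) <= K * Cmod (w - z).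
Proof.
  intros Hf Hr. destruct (analytic_quadratic f rho Hf Hr) as (K & HK & H).
  exists (2 * K). split; [lra|]. intros z w Hz Hw.
  destruct (Req_dec (Cmod (w - z)) 0) as [H0|H0].
  { apply Cmod_eq_0 in H0. replace w with z by (replace w with ((w - z) + z)%C by ring; rewrite H0; ring).
    unfold Cminus. rewrite !Cplus_opp_r, Cmod_0. lra. }
  pose proof (Cmod_ge_0 (w - z)) as Hp.
  apply Rmult_le_reg_l with (Cmod (w - z)); [lra|].
  rewrite <- Cmod_mult.
  replace ((w - z) * (C_derive f w - C_derive f z))%C with
    ((f w - f z - (w - z) * C_derive f z) + (f z - f w - (z - w) * C_derive f w))%C by ring.
  eapply Rle_trans; [apply Cmod_triangle|].
  pose proof (H z w Hz Hw) as H1. pose proof (H w z Hw Hz) as H2. rewrite (Cmod_minus_sym z w) in H2.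
  replace (Cmod (w - z) * (2 * K * Cmod (w - z))) with (K * Cmod (w - z) ^ 2 + K * Cmod (w - z) ^ 2) by ring.
  lra.
Qed.

(** * Locally uniform limits of analytic functions *)

Definition loc_unif (u : nat -> C -> C) (f : C -> C) : Prop :=
  forall rho e, rho < 1 -> 0 < e -> exists N, forall n w, (N <= n)%nat ->
    Cmod w <= rho -> Cmod (u n w - f w) <= e.

(** Cauchy's formula passes to the limit because the kernel is bounded on the circle of radius [r].
    Thus [f] is the Cauchy transform of its own continuous values on that circle, hence
    differentiable. *)
Lemma weierstrass (u : nat -> C -> C) (f : C -> C) :
  (forall n, analytic (u n)) -> loc_unif u f -> analytic f.
Proof.
  intros Hu Hlim. apply cdiff_analytic. intros z0 Hz0. unfold disc in Hz0.
  pose proof (Cmod_ge_0 z0) as Hz00.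
  set (rho := (Cmod z0 + 1) / 2). set (r := (rho + 1) / 2).
  assert (Hr : 0 <= Cmod z0 < rho /\ rho < r < 1) by (unfold r, rho; lra).
  assert (Hcont : forall t, ccont (fun t => f (RtoC r * circ t)%C)%C t).
  { intros t. apply ccont_iff. intros e He.
    destruct (Hlim r (e / 4)) as [N HN]; [lra|lra|].
    assert (Hc : ccont (fun t => u N (RtoC r * circ t)%C)%C t).
    { apply (ccont_analytic (u N) (fun t => RtoC r * circ t)%C); [apply Hu|apply ccont_circle|].
      unfold disc. rewrite Cmod_circle; lra. }
    rewrite ccont_iff in Hc. destruct (Hc (e / 4)) as (d & Hd & H); [lra|].
    exists d. split; [assumption|]. intros s Hs. specialize (H s Hs).
    assert (Hcl : forall s : R, Cmod (u N (RtoC r * circ s)%C - f (RtoC r * circ s)%C) <= e / 4).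
    { intros s'. apply HN; [apply le_n|]. rewrite Cmod_circle; lra. }
    pose proof (Cmod_triangle_minus (f (RtoC r * circ s)%C) (u N (RtoC r * circ s)%C) (f (RtoC r * circ t)%C)).
    pose proof (Cmod_triangle_minus (u N (RtoC r * circ s)%C) (u N (RtoC r * circ t)%C) (f (RtoC r * circ t)%C)).
    pose proof (Hcl s) as Hcs. rewrite Cmod_minus_sym in Hcs. pose proof (Hcl t). lra. }
  assert (Hphi : forall t, ccont (fun t => f (RtoC r * circ t)%C * (RtoC r * circ t)%C)%C t).
  { intros t. apply ccont_mult; [apply Hcont|apply ccont_circle]. }
  assert (Hbd : exists M, 0 <= M /\ forall t, Cmod (f (RtoC r * circ t)%C) <= M).
  { destruct (Hlim r 1) as [N HN]; [lra|lra|].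
    destruct (analytic_bounded (u N) r (Hu N)) as (M & HM & Hb); [lra|].
    exists (M + 1). split; [lra|]. intros t.
    assert (Hc : Cmod (RtoC r * circ t)%C <= r) by (rewrite Cmod_circle; lra).
    specialize (HN N _ (le_n N) Hc). specialize (Hb _ Hc). rewrite Cmod_minus_sym in HN.
    pose proof (Cmod_le_add (f (RtoC r * circ t)%C) (u N (RtoC r * circ t)%C)). lra. }
  assert (Hrep : forall z, Cmod z <= rho -> is_CInt
     (fun t => f (RtoC r * circ t)%C * (RtoC r * circ t)%C * / (RtoC r * circ t - z))%C 0 1 (f z)).
  { intros z Hz.
    assert (HI := CInt_correct _ 0 1 Rle_0_1 (fun t _ => ccont_cauchy_kernel _ r t z ltac:(lra) (Hphi t))).
    set (I := CInt _ 0 1) in HI. replace (f z) with I; [exact HI|].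
    enough (H0 : (I - f z)%C = 0).
    { replace I with ((I - f z) + f z)%C by ring. rewrite H0. ring. }
    apply Cmod_eq_0. apply Rle_antisym; [|apply Cmod_ge_0].
    apply le_epsilon. intros e He. rewrite Rplus_0_l.
    set (q := / (r - rho)). assert (Hq : 0 < q) by (apply Rinv_0_lt_compat; lra).
    (* Two errors share [e]: [eta * q] for replacing [f] by [u N] under the integral, whose kernel
       is at most [q], and [eta] for the values at [z]. *)
    destruct (Hlim r (e / (q + 1))) as [N HN]; [lra|apply Rdiv_lt_0_compat; lra|].
    set (eta := e / (q + 1)) in *.
    assert (Heta : 0 < eta) by (apply Rdiv_lt_0_compat; lra).
    pose proof (cauchy_formula (u N) r z (Hu N) ltac:(lra)) as HC.
    assert (H1 : Cmod (I - u N z) <= (1 - 0) * (eta * q)).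
    { refine (is_CInt_bound _ 0 1 _ _ Rle_0_1 _ (is_CInt_minus _ _ 0 1 _ _ HI HC)).
      intros t _. simpl.
      replace (f (RtoC r * circ t)%C * (RtoC r * circ t)%C * / (RtoC r * circ t - z) -
        u N (RtoC r * circ t)%C * (RtoC r * circ t)%C * / (RtoC r * circ t - z))%C with
        ((f (RtoC r * circ t)%C - u N (RtoC r * circ t)%C) * (RtoC r * circ t)%C * / (RtoC r * circ t - z))%C by ring.
      rewrite !Cmod_mult, Cmod_inv by (apply circle_neq; lra).
      assert (Hc : Cmod (RtoC r * circ t)%C = r) by (apply Cmod_circle; lra).
      assert (A1 : Cmod (f (RtoC r * circ t)%C - u N (RtoC r * circ t)%C) <= eta).
      { rewrite Cmod_minus_sym. apply HN; [apply le_n|lra]. }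
      rewrite <- (Cmod_mult (RtoC r)), Hc.
      assert (A2 : / Cmod (RtoC r * circ t - z) <= q).
      { apply Rinv_le_contravar; [lra|]. pose proof (circle_dist r t z). lra. }
      apply Rmult_le_compat; [| |apply Rle_trans with (eta * 1)|exact A2].
      - apply Rmult_le_pos; [apply Cmod_ge_0|lra].
      - left. apply Rinv_0_lt_compat. pose proof (circle_dist r t z). lra.
      - apply Rmult_le_compat; [apply Cmod_ge_0|lra|exact A1|lra].
      - lra. }
    pose proof (HN N z (le_n N) ltac:(lra)) as H2.
    pose proof (Cmod_triangle_minus I (u N z) (f z)) as H3.
    assert (eta * q + eta = e) by (unfold eta; field; lra). lra. }
  destruct Hbd as (M & HM & Hb).
  destruct (cauchy_transform_quadratic (fun t => f (RtoC r * circ t)%C * (RtoC r * circ t)%C)%C f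
    r rho M) as [D HD].
  - lra.
  - intros t _. apply Hphi.
  - intros t _. rewrite Cmod_mult, Cmod_circle by lra.
    apply Rle_trans with (M * 1); [|lra]. apply Rmult_le_compat; try lra; [apply Cmod_ge_0|apply Hb].
  - exact Hrep.
  - exists (D z0). apply cdiff_of_quadratic with (K := M / (r - rho) ^ 3) (d0 := rho - Cmod z0); [lra|].
    intros w Hw. apply HD; [lra|]. pose proof (Cmod_le_add w z0). lra.
Qed.

(** * Algebra of analytic functions *)

(** The disc is open, so a difference quotient at one of its points needs only nearby values inside
    it. *)
Lemma analytic_ext (f h : C -> C) : (forall z, disc z -> f z = h z) -> analytic f -> analytic h.
Proof.
  intros H Hf. apply cdiff_analytic. intros z Hz. exists (C_derive f z).
  intros e He. destruct (analytic_cdiff f z Hf Hz e He) as (d & Hd & Hw).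
  unfold disc in Hz. exists (Rmin d (1 - Cmod z)). split; [apply Rmin_pos; lra|].
  intros w Hwz. pose proof (Rmin_l d (1 - Cmod z)). pose proof (Rmin_r d (1 - Cmod z)).
  pose proof (Cmod_le_add w z).
  rewrite <- !H by (unfold disc; lra). apply Hw. lra.
Qed.

Lemma analytic_const (c : C) : analytic (fun _ => c).
Proof. intros z _. apply ex_derive_const. Qed.

Lemma analytic_plus (f h : C -> C) :
  analytic f -> analytic h -> analytic (fun z => f z + h z)%C.
Proof.
  intros Hf Hh z Hz.
  exact (ex_derive_plus (K := C_AbsRing) (V := C_NormedModule) f h z (Hf z Hz) (Hh z Hz)).
Qed.

Lemma analytic_mult (f h : C -> C) :
  analytic f -> analytic h -> analytic (fun z => f z * h z)%C.
Proof.
  intros Hf Hh. apply cdiff_analytic. intros z Hz. eexists.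
  apply cdiff_mult; apply analytic_cdiff; assumption.
Qed.

Lemma analytic_id : analytic (fun z => z).
Proof.
  apply cdiff_analytic. intros z _. exists 1. apply cdiff_of_quadratic with (K := 0) (d0 := 1); [lra|].
  intros w _. replace (w - z - (w - z) * 1)%C with (RtoC 0) by ring. rewrite Cmod_0. lra.
Qed.

Lemma analytic_pow (n : nat) : analytic (fun z => z ^ n)%C.
Proof.
  induction n; [exact (analytic_const 1)|]. apply analytic_mult; [apply analytic_id|assumption].
Qed.

Lemma analytic_scal (c : C) (f : C -> C) : analytic f -> analytic (fun z => c * f z)%C.
Proof. intros Hf. apply analytic_mult; [apply analytic_const|assumption]. Qed.

Lemma analytic_lipschitz (f : C -> C) (rho : R) : analytic f -> 0 <= rho < 1 ->
  exists K, 0 <= K /\ forall z w, Cmod z <= rho -> Cmod w <= rho ->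
    Cmod (f w - f z) <= K * Cmod (w - z).
Proof.
  intros Hf Hr. destruct (analytic_quadratic f rho Hf Hr) as (K & HK & H).
  destruct (C_derive_lipschitz f rho Hf Hr) as (K' & HK' & H').
  pose proof (Cmod_ge_0 (C_derive f 0)) as Hd.
  exists (2 * K + (Cmod (C_derive f 0) + K')). split; [lra|]. intros z w Hz Hw.
  replace (f w - f z)%C with ((f w - f z - (w - z) * C_derive f z) + (w - z) * C_derive f z)%C by ring.
  eapply Rle_trans; [apply Cmod_triangle|]. rewrite Cmod_mult.
  pose proof (Cmod_ge_0 (w - z)) as Hp.
  assert (H1 : Cmod (f w - f z - (w - z) * C_derive f z) <= 2 * K * Cmod (w - z)).
  { eapply Rle_trans; [apply H; assumption|].
    simpl. rewrite Rmult_1_r, <- Rmult_assoc. apply Rmult_le_compat_r; [assumption|].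
    rewrite (Rmult_comm 2). apply Rmult_le_compat_l; [assumption|].
    pose proof (Cmod_minus_le w z). lra. }
  assert (H2 : Cmod (C_derive f z) <= Cmod (C_derive f 0) + K').
  { eapply Rle_trans; [apply (Cmod_le_add _ (C_derive f 0))|]. apply Rplus_le_compat_l.
    eapply Rle_trans; [apply H'; [rewrite Cmod_0; lra|assumption]|].
    replace (z - 0)%C with z by ring.
    apply Rle_trans with (K' * 1); [apply Rmult_le_compat_l; lra|lra]. }
  pose proof (Rmult_le_compat_l _ _ _ Hp H2). lra.
Qed.

Lemma analytic_dilate (f : C -> C) (r : R) : 0 <= r <= 1 -> analytic f ->
  analytic (fun z => f (RtoC r * z))%C.
Proof.
  intros Hr Hf. apply cdiff_analytic. intros z Hz.
  assert (Hz' : disc (RtoC r * z)).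
  { unfold disc in *. eapply Rle_lt_trans; [apply Cmod_ray, Hr|assumption]. }
  exists (RtoC r * C_derive f (RtoC r * z))%C.
  intros e He. destruct (analytic_cdiff f _ Hf Hz' e He) as (d & Hd & H).
  exists d. split; [assumption|]. intros w Hw.
  pose proof (Cmod_ray (w - z) r Hr) as Hrw.
  specialize (H (RtoC r * w)%C). replace (RtoC r * w - RtoC r * z)%C with (RtoC r * (w - z))%C in H by ring.
  replace ((w - z) * (RtoC r * C_derive f (RtoC r * z)))%C with
    (RtoC r * (w - z) * C_derive f (RtoC r * z))%C by ring.
  eapply Rle_trans; [apply H; lra|]. apply Rmult_le_compat_l; lra.
Qed.

(** * The Volterra operator *)

Section Volterra.
Variable g : C -> C.
Hypothesis g_analytic : analytic g.

(** Integrability comes from the continuity of [C_derive g] along the segment. Every later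
    computation with [volterra] goes through this lemma and uniqueness of the integral. *)
Lemma volterra_spec (f : C -> C) (z : C) : analytic f -> disc z ->
  is_CInt (fun t => f (RtoC t * z) * C_derive g (RtoC t * z) * z)%C 0 1 (volterra g f z).
Proof using g_analytic.
  intros Hf Hz. unfold disc in Hz. apply CInt_correct; [lra|]. intros t Ht.
  apply ccont_mult; [|apply ccont_const].
  apply ccont_mult.
  - apply (ccont_analytic f (fun t => RtoC t * z)%C); [assumption|apply ccont_ray|].
    unfold disc. pose proof (Cmod_ray z t Ht). lra.
  (* Continuity at the endpoint [t = 1] involves parameters slightly above 1, hence a radius
     strictly between [Cmod z] and 1. *)
  - set (rho := (Cmod z + 1) / 2). pose proof (Cmod_ge_0 z) as Hz0.
    destruct (C_derive_lipschitz g rho g_analytic) as (K & HK & HL); [unfold rho; lra|].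
    pose proof (ccont_ray z t) as Hc. rewrite ccont_iff in Hc. apply ccont_iff. intros e He.
    destruct (Hc (Rmin (rho - Cmod z) (e / (K + 1)))) as (d & Hd & H).
    { apply Rmin_pos; [unfold rho; lra|apply Rdiv_lt_0_compat; lra]. }
    exists d. split; [assumption|]. intros s Hs. specialize (H s Hs).
    pose proof (Rmin_l (rho - Cmod z) (e / (K + 1))).
    pose proof (Rmin_r (rho - Cmod z) (e / (K + 1))).
    pose proof (Cmod_ray z t Ht) as Htz.
    pose proof (Cmod_le_add (RtoC s * z) (RtoC t * z)) as Hsz.
    eapply Rle_lt_trans; [apply HL; unfold rho in *; lra|].
    pose proof (Cmod_ge_0 (RtoC s * z - RtoC t * z)) as Hp.
    apply Rle_lt_trans with ((K + 1) * Cmod (RtoC s * z - RtoC t * z)).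
    { apply Rmult_le_compat_r; lra. }
    rewrite Rmult_comm. apply Rlt_div_r; lra.
Qed.

Lemma volterra_plus (f h : C -> C) (z : C) : analytic f -> analytic h -> disc z ->
  volterra g (fun w => f w + h w)%C z = (volterra g f z + volterra g h z)%C.
Proof using g_analytic.
  intros Hf Hh Hz. apply CInt_unique.
  apply (is_CInt_ext (fun t => f (RtoC t * z) * C_derive g (RtoC t * z) * z
    + h (RtoC t * z) * C_derive g (RtoC t * z) * z)%C); [lra|intros t _; ring|].
  apply is_CInt_plus; apply volterra_spec; assumption.
Qed.

Lemma volterra_scal (c : C) (f : C -> C) (z : C) : analytic f -> disc z ->
  volterra g (fun w => c * f w)%C z = (c * volterra g f z)%C.
Proof using g_analytic.
  intros Hf Hz. apply CInt_unique.
  apply (is_CInt_ext (fun t => c * (f (RtoC t * z) * C_derive g (RtoC t * z) * z))%C);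
    [lra|intros t _; ring|].
  apply is_CInt_mult, volterra_spec; assumption.
Qed.

Lemma volterra_zero (z : C) : disc z -> volterra g (fun _ => 0) z = 0.
Proof using g_analytic.
  intros Hz.
  transitivity (volterra g (fun w => 0 * (fun _ => 0) w)%C z).
  { apply CInt_ext; [lra|]. intros t _. ring. }
  rewrite (volterra_scal 0 (fun _ => 0)) by (assumption || apply analytic_const). ring.
Qed.

(** On the segment the derivative of [g] is bounded by its modulus at 0 plus a Lipschitz constant,
    so uniform convergence on the disc of radius [Cmod z] passes through the integral. *)
Lemma volterra_loc_unif (u : nat -> C -> C) (f : C -> C) (z : C) :
  (forall n, analytic (u n)) -> analytic f -> loc_unif u f -> disc z ->
  forall e, 0 < e -> exists N, forall n, (N <= n)%nat ->
    Cmod (volterra g (u n) z - volterra g f z) <= e.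
Proof using g_analytic.
  intros Hu Hf Hlim Hz e He. pose proof Hz as Hz1. unfold disc in Hz. pose proof (Cmod_ge_0 z) as Hz0.
  destruct (C_derive_lipschitz g (Cmod z) g_analytic) as (K & HK & HL); [lra|].
  set (M := Cmod (C_derive g 0) + K).
  pose proof (Cmod_ge_0 (C_derive g 0)) as Hd0.
  destruct (Hlim (Cmod z) (e / (M + 1))) as [N HN]; [assumption|apply Rdiv_lt_0_compat; unfold M; lra|].
  exists N. intros n Hn.
  assert (He' : 0 < e / (M + 1)) by (apply Rdiv_lt_0_compat; unfold M; lra).
  replace e with ((1 - 0) * (e / (M + 1) * (M + 1))) by (field; unfold M; lra).
  refine (is_CInt_bound _ 0 1 _ _ Rle_0_1 _
    (is_CInt_minus _ _ 0 1 _ _ (volterra_spec (u n) z (Hu n) Hz1) (volterra_spec f z Hf Hz1))).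
  intros t Ht. pose proof (Cmod_ray z t Ht) as Htz.
  replace (u n (RtoC t * z) * C_derive g (RtoC t * z) * z - f (RtoC t * z) * C_derive g (RtoC t * z) * z)%C
    with ((u n (RtoC t * z) - f (RtoC t * z)) * (C_derive g (RtoC t * z) * z))%C by ring.
  rewrite !Cmod_mult.
  apply Rmult_le_compat; [apply Cmod_ge_0|apply Rmult_le_pos; apply Cmod_ge_0|apply HN; assumption|].
  apply Rle_trans with (M * 1); [|lra].
  apply Rmult_le_compat; [apply Cmod_ge_0|assumption| |lra].
  eapply Rle_trans; [apply (Cmod_le_add _ (C_derive g 0))|]. apply Rplus_le_compat_l.
  eapply Rle_trans; [apply HL; [rewrite Cmod_0|]; lra|].
  replace (RtoC t * z - 0)%C with (RtoC t * z)%C by ring.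
  apply Rle_trans with (K * 1); [apply Rmult_le_compat_l; lra|lra].
Qed.
End Volterra.

(** * Weighted spaces *)

Section Weighted.
Variable v : R -> R.
Hypothesis v_weight : weight v.

Lemma weight_pos (z : C) : disc z -> 0 < v (Cmod z).
Proof using v_weight. intros Hz. apply (proj1 v_weight). split; [apply Cmod_ge_0|exact Hz]. Qed.

Lemma weight_decr (r s : R) : 0 <= r -> r <= s -> s < 1 -> v s <= v r.
Proof using v_weight. apply (proj2 (proj2 v_weight)). Qed.

Lemma weighted_modulus_ge_0 (f : C -> C) (z : C) : disc z -> 0 <= weighted_modulus v f z.
Proof using v_weight.
  intros Hz. apply Rmult_le_pos; [apply Cmod_ge_0|]. left. apply weight_pos, Hz.
Qed.

Lemma weighted_modulus_plus (f h : C -> C) (z : C) : disc z ->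
  weighted_modulus v (fun z => f z + h z)%C z <= weighted_modulus v f z + weighted_modulus v h z.
Proof using v_weight.
  intros Hz. unfold weighted_modulus. rewrite <- Rmult_plus_distr_r.
  apply Rmult_le_compat_r; [left; apply weight_pos, Hz|apply Cmod_triangle].
Qed.

Lemma weighted_modulus_scal (c : C) (f : C -> C) (z : C) :
  weighted_modulus v (fun z => c * f z)%C z = Cmod c * weighted_modulus v f z.
Proof using. unfold weighted_modulus. rewrite Cmod_mult. ring. Qed.

Lemma disc_0 : disc 0.
Proof. unfold disc. rewrite Cmod_0. lra. Qed.

(** The point 0 keeps the supremum away from [m_infty]. Finiteness is recorded along with the bound
    because [real] sends infinite values to 0, so a bound on [weighted_norm] alone would say
    nothing. *)
Lemma weighted_sup_bounded (f : C -> C) (B : R) :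
  (forall z, disc z -> weighted_modulus v f z <= B) ->
  is_finite (weighted_sup v f) /\ weighted_norm v f <= B.
Proof using v_weight.
  intros H. unfold weighted_norm, weighted_sup.
  set (E := fun x : R => exists z : C, disc z /\ x = weighted_modulus v f z).
  destruct (Lub_Rbar_correct E) as [H1 H2].
  assert (HB : Rbar_le (Lub_Rbar E) B).
  { apply H2. intros x (z & Hz & ->). apply H, Hz. }
  assert (H0 : Rbar_le (weighted_modulus v f 0) (Lub_Rbar E)).
  { apply H1. exists 0. split; [apply disc_0|reflexivity]. }
  destruct (Lub_Rbar E); simpl in *; [split; [reflexivity|assumption]|contradiction|contradiction].
Qed.

Lemma weighted_modulus_le_norm (f : C -> C) (z : C) :
  is_finite (weighted_sup v f) -> disc z -> weighted_modulus v f z <= weighted_norm v f.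
Proof using.
  intros Hfin Hz. unfold weighted_norm.
  change (Rbar_le (weighted_modulus v f z) (real (weighted_sup v f))).
  rewrite Hfin. unfold weighted_sup. apply Lub_Rbar_correct. exists z. auto.
Qed.

Lemma weighted_norm_ext (f h : C -> C) : (forall z, disc z -> f z = h z) ->
  weighted_norm v f = weighted_norm v h.
Proof using.
  intros H. unfold weighted_norm, weighted_sup. f_equal. apply Lub_Rbar_eqset.
  intros x. split; intros (z & Hz & ->); exists z; (split; [assumption|]);
    unfold weighted_modulus; rewrite H by assumption; reflexivity.
Qed.

Lemma H_infty_iff (f : C -> C) : H_infty v f <-> analytic f /\
  exists B, forall z, disc z -> weighted_modulus v f z <= B.
Proof using v_weight.
  split; intros [Hf H]; (split; [assumption|]).
  - exists (weighted_norm v f). intros z Hz. apply weighted_modulus_le_norm; assumption.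
  - destruct H as [B HB]. apply (weighted_sup_bounded f B HB).
Qed.

Lemma H_zero_iff (f : C -> C) : H_zero v f <-> analytic f /\
  forall e, 0 < e -> exists r, r < 1 /\ forall z, r < Cmod z < 1 -> weighted_modulus v f z <= e.
Proof using v_weight.
  split; intros [Hf H]; (split; [assumption|]).
  - intros e He.
    destruct (H (fun x => Rabs x <= e)) as [d Hd].
    { exists (mkposreal e He). intros y Hy.
      assert (Hy' : Rabs (y - 0) < e) by exact Hy. rewrite Rminus_0_r in Hy'. lra. }
    exists (1 - d). split; [pose proof (cond_pos d); lra|]. intros z Hz.
    assert (Hz1 : ball 1 d (Cmod z)).
    { change (Rabs (Cmod z - 1) < d). rewrite Rabs_left; lra. }
    eapply Rle_trans; [apply Rle_abs|]. exact (Hd (Cmod z) Hz1 (proj2 Hz) z eq_refl).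
  - intros P [e HP]. destruct (H (e / 2)) as (r & Hr & Hz); [pose proof (cond_pos e); lra|].
    assert (Hd : 0 < 1 - r) by lra. exists (mkposreal _ Hd). intros y Hy Hy1 z Hzy.
    assert (Hy' : Rabs (y - 1) < 1 - r) by exact Hy. rewrite Rabs_left in Hy' by lra.
    apply HP. change (Rabs (weighted_modulus v f z - 0) < e).
    rewrite Rminus_0_r, Rabs_pos_eq.
    + specialize (Hz z ltac:(lra)). pose proof (cond_pos e). lra.
    + apply weighted_modulus_ge_0. unfold disc. lra.
Qed.

Lemma H_zero_ext (f h : C -> C) : (forall z, disc z -> f z = h z) -> H_zero v f -> H_zero v h.
Proof using v_weight.
  rewrite !H_zero_iff. intros H [Hf Hd]. split; [exact (analytic_ext f h H Hf)|].
  intros e He. destruct (Hd e He) as (r & Hr & Hz). exists r. split; [assumption|].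
  intros z Hrz. specialize (Hz z Hrz). unfold weighted_modulus in *.
  rewrite <- H by (unfold disc; lra). exact Hz.
Qed.

Lemma H_zero_plus (f h : C -> C) : H_zero v f -> H_zero v h -> H_zero v (fun z => f z + h z)%C.
Proof using v_weight.
  rewrite !H_zero_iff. intros [Hf Hfd] [Hh Hhd]. split; [apply analytic_plus; assumption|].
  intros e He. destruct (Hfd (e / 2)) as (r & Hr & H1); [lra|].
  destruct (Hhd (e / 2)) as (s & Hs & H2); [lra|].
  exists (Rmax r s). split; [apply Rmax_lub_lt; assumption|]. intros z Hz.
  pose proof (Rmax_l r s). pose proof (Rmax_r r s).
  eapply Rle_trans; [apply weighted_modulus_plus; unfold disc; lra|].
  specialize (H1 z ltac:(lra)). specialize (H2 z ltac:(lra)). lra.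
Qed.

Lemma H_zero_scal (c : C) (f : C -> C) : H_zero v f -> H_zero v (fun z => c * f z)%C.
Proof using v_weight.
  rewrite !H_zero_iff. intros [Hf Hfd]. split; [apply analytic_scal; assumption|].
  intros e He. pose proof (Cmod_ge_0 c) as Hc.
  destruct (Hfd (e / (Cmod c + 1))) as (r & Hr & H1); [apply Rdiv_lt_0_compat; lra|].
  exists r. split; [assumption|]. intros z Hz. rewrite weighted_modulus_scal. specialize (H1 z Hz).
  assert (0 <= weighted_modulus v f z) by (apply weighted_modulus_ge_0; unfold disc; lra).
  apply Rle_trans with ((Cmod c + 1) * weighted_modulus v f z); [apply Rmult_le_compat_r; lra|].
  rewrite Rmult_comm. apply Rle_div_r; lra.
Qed.

Lemma H_zero_minus (f h : C -> C) : H_zero v f -> H_zero v h -> H_zero v (fun z => f z - h z)%C.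
Proof using v_weight.
  intros Hf Hh. apply (H_zero_ext (fun z => f z + (-1) * h z)%C); [intros z _; ring|].
  apply H_zero_plus; [assumption|apply H_zero_scal, Hh].
Qed.

(** Near the circle the limit gives the bound 1; on the remaining closed disc [f] is bounded and [v]
    is at most [v 0]. *)
Lemma H_zero_H_infty (f : C -> C) : H_zero v f -> H_infty v f.
Proof using v_weight.
  rewrite H_zero_iff, H_infty_iff. intros [Hf Hd]. split; [assumption|].
  destruct (Hd 1 Rlt_0_1) as (r & Hr & H). destruct (analytic_bounded f r Hf Hr) as (M & HM & Hb).
  assert (Hv0 : 0 < v 0) by (apply (proj1 v_weight); lra).
  assert (0 <= M * v 0) by (apply Rmult_le_pos; lra).
  exists (1 + M * v 0). intros z Hz. unfold disc in Hz.
  destruct (Rle_lt_dec (Cmod z) r) as [Hzr|Hzr].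
  - apply Rle_trans with (M * v 0); [|lra]. apply Rmult_le_compat.
    + apply Cmod_ge_0. + left. apply weight_pos, Hz. + apply Hb, Hzr.
    + apply weight_decr; [lra|apply Cmod_ge_0|assumption].
  - specialize (H z (conj Hzr Hz)). lra.
Qed.

Lemma weighted_norm_triangle (a b c : C -> C) : H_zero v a -> H_zero v b -> H_zero v c ->
  weighted_norm v (fun z => a z - c z)%C <=
  weighted_norm v (fun z => a z - b z)%C + weighted_norm v (fun z => b z - c z)%C.
Proof using v_weight.
  intros Ha Hb Hc. apply weighted_sup_bounded. intros z Hz.
  destruct (H_zero_H_infty _ (H_zero_minus _ _ Ha Hb)) as [_ H1].
  destruct (H_zero_H_infty _ (H_zero_minus _ _ Hb Hc)) as [_ H2].
  pose proof (weighted_modulus_le_norm _ z H1 Hz). pose proof (weighted_modulus_le_norm _ z H2 Hz).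
  pose proof (weighted_modulus_plus (fun z => a z - b z)%C (fun z => b z - c z)%C z Hz) as H3.
  unfold weighted_modulus in *.
  replace (a z - b z + (b z - c z))%C with (a z - c z)%C in H3 by ring. lra.
Qed.

Lemma weighted_norm_self (a : C -> C) : weighted_norm v (fun z => a z - a z)%C <= 0.
Proof using v_weight.
  apply weighted_sup_bounded. intros z _. unfold weighted_modulus.
  replace (a z - a z)%C with (RtoC 0) by ring. rewrite Cmod_0. lra.
Qed.

(** Without a cluster point, the open sets of functions from which the sequence eventually keeps a
    positive distance cover the closure. They increase with the starting index, so a finite subcover
    would separate some term from itself. *)
Lemma relatively_compact_cluster (A : (C -> C) -> Prop) (u : nat -> C -> C) :
  relatively_compact (H_zero v) (weighted_norm v) A ->
  (forall n, A (u n)) -> (forall n, H_zero v (u n)) ->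
  exists h, H_zero v h /\ forall r n0, 0 < r ->
    exists n, (n0 <= n)%nat /\ weighted_norm v (fun z => u n z - h z)%C < r.
Proof using v_weight.
  intros HA Hu HX. apply NNPP. intros Hno.
  (* The distance [r] may depend on [h]; halving it makes [U m] open by the triangle inequality. *)
  set (U := fun (m : nat) (h : C -> C) => H_zero v h /\ exists r, 0 < r /\
    forall n, (m <= n)%nat -> r <= weighted_norm v (fun z => u n z - h z)%C).
  destruct (HA nat U) as [l Hl].
  - intros m h Hh [_ (r & Hr & H)]. exists (r / 2). split; [lra|]. intros k [Hk Hkh].
    split; [assumption|]. exists (r / 2). split; [lra|]. intros n Hn.
    pose proof (weighted_norm_triangle (u n) k h (HX n) Hk Hh). specialize (H n Hn). lra.
  - intros h [Hh _]. apply NNPP. intros HU. apply Hno. exists h. split; [assumption|].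
    intros r n0 Hr. apply NNPP. intros Hn. apply HU. exists n0. split; [assumption|].
    exists r. split; [assumption|]. intros n Hnn. apply Rnot_lt_le. intros Hlt.
    apply Hn. exists n. auto.
  (* The term [u m] lies in some [U i] with [i <= m], so it would have positive distance from
     itself. *)
  - set (m := list_max l).
    destruct (Hl (u m)) as (i & Hi & [_ (r & Hr & H)]).
    { split; [apply HX|]. intros r Hr. exists (u m). split; [apply Hu|]. split; [apply HX|].
      pose proof (weighted_norm_self (u m)). lra. }
    assert (Him : (i <= m)%nat).
    { pose proof (proj1 (list_max_le l m) (le_n m)) as HF. rewrite Forall_forall in HF. apply HF, Hi. }
    specialize (H m Him). pose proof (weighted_norm_self (u m)). lra.
Qed.

(* Norm convergence implies pointwise convergence, so a pointwise limit is the
   only possible cluster point. *)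
Lemma compact_operator_limit (T : (C -> C) -> C -> C) (u : nat -> C -> C) (F : C -> C) :
  compact_operator (H_zero v) (weighted_norm v) T ->
  (forall n, H_zero v (u n)) -> (forall n, weighted_norm v (u n) <= 1) ->
  (forall z e, disc z -> 0 < e -> exists N, forall n, (N <= n)%nat -> Cmod (T (u n) z - F z) <= e) ->
  H_zero v F /\ forall r n0, 0 < r ->
    exists n, (n0 <= n)%nat /\ weighted_norm v (fun z => T (u n) z - F z)%C < r.
Proof using v_weight.
  intros [HT HK] Hu Hn Hlim.
  destruct (relatively_compact_cluster _ (fun n => T (u n)) HK) as (h & Hh & Hc).
  { intros n. exists (u n). auto. }
  { intros n. apply HT, Hu. }
  assert (HhF : forall z, disc z -> h z = F z).
  { intros z Hz. enough (H0 : (h z - F z)%C = 0).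
    { replace (h z) with ((h z - F z) + F z)%C by ring. rewrite H0. ring. }
    apply Cmod_eq_0. apply Rle_antisym; [|apply Cmod_ge_0].
    apply le_epsilon. intros e He. rewrite Rplus_0_l.
    pose proof (weight_pos z Hz) as Hv.
    destruct (Hlim z (e / 2) Hz) as [N HN]; [lra|].
    (* The factor [v (Cmod z)] cancels the weight, turning norm closeness into an error of at most
       [e / 2] at the point [z]. *)
    destruct (Hc (e / 2 * v (Cmod z)) N) as (n & HnN & Hlt); [apply Rmult_lt_0_compat; lra|].
    specialize (HN n HnN). cbv beta in Hlt.
    destruct (H_zero_H_infty _ (H_zero_minus _ _ (HT _ (Hu n)) Hh)) as [_ Hfin].
    pose proof (weighted_modulus_le_norm _ z Hfin Hz) as Hle. unfold weighted_modulus in Hle.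
    assert (Hle2 : Cmod (T (u n) z - h z) * v (Cmod z) <= e / 2 * v (Cmod z)) by lra.
    apply Rmult_le_reg_r in Hle2; [|assumption].
    pose proof (Cmod_triangle_minus (h z) (T (u n) z) (F z)) as Ht.
    rewrite (Cmod_minus_sym (h z) (T (u n) z)) in Ht. lra. }
  split; [exact (H_zero_ext h F HhF Hh)|].
  intros r n0 Hr. destruct (Hc r n0 Hr) as (n & Hnn & Hlt). exists n. split; [assumption|].
  erewrite weighted_norm_ext; [exact Hlt|]. intros z Hz. simpl. rewrite HhF by assumption. reflexivity.
Qed.
End Weighted.

(** * Telescoping sequences *)

Lemma half_pow_le (e : R) : 0 < e -> exists N, forall n, (N <= n)%nat -> 2 * (1 / 2) ^ n <= e.
Proof.
  intros He. destruct (pow_lt_1_zero (1 / 2)) with (y := e / 2) as [N HN].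
  - rewrite Rabs_pos_eq; lra.
  - lra.
  - exists N. intros n Hn. specialize (HN n Hn). pose proof (Rle_abs ((1 / 2) ^ n)). lra.
Qed.

(** The factor [c] is 1 for plain convergence and [v (Cmod z)] for the weighted tail estimate. *)
Lemma geometric_telescope (x : nat -> C) (c : R) (N : nat) : 0 <= c ->
  (forall n, (N <= n)%nat -> Cmod (x (S n) - x n) * c <= (1 / 2) ^ n) ->
  forall n m, (N <= n)%nat -> (n <= m)%nat -> Cmod (x m - x n) * c <= 2 * (1 / 2) ^ n.
Proof.
  intros Hc H n m Hn Hm.
  (* The exact geometric sum is needed for the induction; the rounded bound does not reproduce
     itself. *)
  enough (Hs : Cmod (x m - x n) * c <= 2 * (1 / 2) ^ n - 2 * (1 / 2) ^ m).
  { assert (0 < (1 / 2) ^ m) by (apply pow_lt; lra). lra. }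
  induction Hm as [|m Hm IH].
  - replace (x n - x n)%C with (RtoC 0) by ring. rewrite Cmod_0. lra.
  - pose proof (Cmod_triangle_minus (x (S m)) (x m) (x n)) as Ht.
    apply (Rmult_le_compat_r c) in Ht; [|assumption].
    specialize (H m ltac:(lia)). simpl. lra.
Qed.

Lemma Cauchy_limit (x : nat -> C) (e : nat -> R) (N : nat) :
  (forall d, 0 < d -> exists n, (N <= n)%nat /\ e n <= d) ->
  (forall n m, (N <= n)%nat -> (n <= m)%nat -> Cmod (x m - x n) <= e n) ->
  exists l, forall d, 0 < d -> exists M, forall n, (M <= n)%nat -> Cmod (x n - l) <= d.
Proof.
  intros He H.
  assert (Hcomp : forall (p : C -> R), (forall a b, Rabs (p a - p b) <= Cmod (a - b)) ->
    exists l, is_lim_seq (fun n => p (x n)) (Finite l)).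
  { intros p Hp. apply ex_lim_seq_cauchy_corr. intros d.
    destruct (He (d / 3)) as (n & Hn & Hd); [pose proof (cond_pos d); lra|].
    exists n. intros i j Hi Hj.
    eapply Rle_lt_trans; [apply Hp|].
    pose proof (Cmod_triangle_minus (x i) (x n) (x j)) as Ht.
    rewrite (Cmod_minus_sym (x n) (x j)) in Ht.
    pose proof (H n i Hn Hi). pose proof (H n j Hn Hj). pose proof (cond_pos d). lra. }
  assert (Hmax : forall z, Rabs (fst z) <= Cmod z /\ Rabs (snd z) <= Cmod z).
  { intros z. pose proof (Rmax_Cmod z) as Hz. split; (eapply Rle_trans; [|exact Hz]);
     [apply Rmax_l|apply Rmax_r]. }
  destruct (Hcomp fst) as [l1 H1]; [intros a b; apply (Hmax (a - b)%C)|].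
  destruct (Hcomp snd) as [l2 H2]; [intros a b; apply (Hmax (a - b)%C)|].
  exists (l1, l2). intros d Hd. apply is_lim_seq_spec in H1, H2.
  assert (Hd4 : 0 < d / 4) by lra.
  destruct (H1 (mkposreal _ Hd4)) as [M1 HM1]. destruct (H2 (mkposreal _ Hd4)) as [M2 HM2].
  exists (max M1 M2). intros n Hn. specialize (HM1 n ltac:(lia)). specialize (HM2 n ltac:(lia)).
  simpl in HM1, HM2. eapply Rle_trans; [apply Cmod_2Rmax|].
  apply Rle_trans with (2 * (d / 4)); [|lra].
  apply Rmult_le_compat; [apply sqrt_pos| | |].
  - eapply Rle_trans; [apply Rabs_pos|apply Rmax_l].
  - rewrite <- (sqrt_square 2) at 2 by lra. apply sqrt_le_1_alt. lra.
  - apply Rmax_lub; simpl; left; assumption.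
Qed.

Lemma loc_unif_geometric (u : nat -> C -> C) :
  (forall rho, rho < 1 -> exists N, forall n w, (N <= n)%nat -> Cmod w <= rho ->
    Cmod (u (S n) w - u n w) <= (1 / 2) ^ n) ->
  exists f, loc_unif u f.
Proof.
  intros H.
  assert (Htel : forall rho, rho < 1 -> exists N, forall n m w, (N <= n)%nat -> (n <= m)%nat ->
    Cmod w <= rho -> Cmod (u m w - u n w) <= 2 * (1 / 2) ^ n).
  { intros rho Hrho. destruct (H rho Hrho) as [N HN]. exists N. intros n m w Hn Hm Hw.
    pose proof (geometric_telescope (fun k => u k w) 1 N Rle_0_1) as Hg.
    rewrite <- (Rmult_1_r (Cmod _)). apply Hg; [|assumption|assumption].
    intros k Hk. rewrite Rmult_1_r. apply HN; assumption. }
  (* With [disc w] inside the existential, the choice of limits yields a total function, arbitrary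
     outside the disc. *)
  assert (Hpt : forall w, exists l, disc w ->
    forall d, 0 < d -> exists M, forall n, (M <= n)%nat -> Cmod (u n w - l) <= d).
  { intros w. destruct (classic (disc w)) as [Hw|Hw]; [|exists 0; contradiction].
    destruct (Htel (Cmod w) Hw) as [N HN].
    destruct (Cauchy_limit (fun n => u n w) (fun n => 2 * (1 / 2) ^ n) N) as [l Hl].
    - intros d Hd. destruct (half_pow_le d Hd) as [M HM]. exists (max N M).
      split; [lia|apply HM; lia].
    - intros n m Hn Hm. apply HN; [assumption|assumption|lra].
    - exists l. intros _. exact Hl. }
  exists (fun w => proj1_sig (constructive_indefinite_description _ (Hpt w))).
  intros rho e Hrho He. destruct (Htel rho Hrho) as [N HN].
  destruct (half_pow_le (e / 2)) as [M HM]; [lra|].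
  exists (max N M). intros n w Hn Hw.
  destruct (constructive_indefinite_description _ (Hpt w)) as [l Hl]; simpl.
  destruct (Hl ltac:(unfold disc; lra) (e / 2)) as [M' HM']; [lra|].
  pose proof (HN n (max n M') w ltac:(lia) ltac:(lia) Hw) as H1.
  specialize (HM n ltac:(lia)). specialize (HM' (max n M') ltac:(lia)).
  pose proof (Cmod_triangle_minus (u n w) (u (max n M') w) l) as Ht.
  rewrite (Cmod_minus_sym (u n w) (u (max n M') w)) in Ht. lra.
Qed.

(** * The inclusion *)

(** The decay of [v] at the circle is what puts dilates and monomials into [H_zero]. *)
Lemma H_zero_of_bounded (v : R -> R) (f : C -> C) (M : R) : weight v ->
  filterlim v (at_left 1) (locally 0) ->
  analytic f -> (forall z, disc z -> Cmod (f z) <= M) -> H_zero v f.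
Proof.
  intros Hv Hlim Hf HM. apply (H_zero_iff v Hv). split; [assumption|]. intros e He.
  assert (HM0 : 0 <= M) by (eapply Rle_trans; [apply Cmod_ge_0|apply (HM 0), disc_0]).
  assert (He' : 0 < e / (M + 1)) by (apply Rdiv_lt_0_compat; lra).
  destruct (Hlim (fun x => Rabs x < e / (M + 1))) as [d Hd].
  { exists (mkposreal _ He'). intros y Hy.
    assert (Hy' : Rabs (y - 0) < e / (M + 1)) by exact Hy. rewrite Rminus_0_r in Hy'. exact Hy'. }
  exists (1 - d). split; [pose proof (cond_pos d); lra|]. intros z Hz.
  assert (Hb : ball 1 d (Cmod z)) by (change (Rabs (Cmod z - 1) < d); rewrite Rabs_left; lra).
  specialize (Hd (Cmod z) Hb (proj2 Hz)). cbv beta in Hd.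
  assert (Hzd : disc z) by (unfold disc; lra).
  pose proof (weight_pos v Hv z Hzd) as Hvz. rewrite Rabs_pos_eq in Hd by lra.
  unfold weighted_modulus. specialize (HM z Hzd).
  apply Rle_trans with (M * (e / (M + 1))).
  - apply Rmult_le_compat; [apply Cmod_ge_0| | |]; lra.
  - apply Rle_trans with ((M + 1) * (e / (M + 1))); [apply Rmult_le_compat_r; lra|].
    right. field. lra.
Qed.

(** Radii in [[0, 1)] tending to 1, used as dilation factors for the inclusion and as radii of
    exhausting discs for the series. *)
Definition dilation_radius (n : nat) : R := 1 - / (INR n + 2).

Lemma dilation_radius_bounds (n : nat) : 0 <= dilation_radius n < 1.
Proof.
  unfold dilation_radius. pose proof (pos_INR n).
  assert (0 < / (INR n + 2)) by (apply Rinv_0_lt_compat; lra).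
  assert (/ (INR n + 2) <= / 1) by (apply Rinv_le_contravar; lra). lra.
Qed.

Lemma dilation_radius_lim (e : R) : 0 < e ->
  exists N, forall n, (N <= n)%nat -> 1 - dilation_radius n <= e.
Proof.
  intros He. destruct (nfloor_ex (/ e)) as [N HN]; [left; apply Rinv_0_lt_compat, He|].
  exists N. intros n Hn. apply le_INR in Hn. unfold dilation_radius.
  replace (1 - (1 - / (INR n + 2))) with (/ (INR n + 2)) by ring.
  rewrite <- (Rinv_inv e). apply Rinv_le_contravar; [apply Rinv_0_lt_compat, He|lra].
Qed.

Lemma volterra_H_infty_unit (g f : C -> C) (v : R -> R) : analytic g -> weight v ->
  filterlim v (at_left 1) (locally 0) ->
  compact_operator (H_zero v) (weighted_norm v) (volterra g) ->
  H_infty v f -> weighted_norm v f <= 1 -> H_zero v (volterra g f).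
Proof.
  intros Hg Hv Hlim Hcomp [Hf Hfin] Hn.
  set (u := fun (n : nat) (z : C) => f (RtoC (dilation_radius n) * z)%C).
  assert (Hu : forall n, analytic (u n)).
  { intros n. apply analytic_dilate; [pose proof (dilation_radius_bounds n); lra|assumption]. }
  assert (Hball : forall n z, disc z -> Cmod (RtoC (dilation_radius n) * z) <= Cmod z).
  { intros n z Hz. apply Cmod_ray. pose proof (dilation_radius_bounds n). lra. }
  apply (compact_operator_limit v Hv (volterra g) u (volterra g f) Hcomp).
  - intros n. pose proof (dilation_radius_bounds n) as Hr.
    destruct (analytic_bounded f (dilation_radius n) Hf) as (M & HM & Hb); [lra|].
    apply (H_zero_of_bounded v (u n) M Hv Hlim (Hu n)). intros z Hz. apply Hb.
    rewrite Cmod_mult, Cmod_R, Rabs_pos_eq by lra. unfold disc in Hz.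
    apply Rle_trans with (dilation_radius n * 1); [apply Rmult_le_compat_l; lra|lra].
  - intros n. apply (weighted_sup_bounded v Hv). intros z Hz. specialize (Hball n z Hz).
    unfold disc in Hz.
    (* Dilation moves points inward, where the non-increasing weight is at least as large, so it
       does not increase the norm. *)
    apply Rle_trans with (weighted_modulus v f (RtoC (dilation_radius n) * z)%C).
    + apply Rmult_le_compat_l; [apply Cmod_ge_0|].
      apply (weight_decr v Hv); [apply Cmod_ge_0|assumption|assumption].
    + eapply Rle_trans; [|exact Hn]. apply weighted_modulus_le_norm; [assumption|].
      unfold disc. lra.
  - intros z e Hz He. apply volterra_loc_unif; try assumption.
    (* Dilation by [r] moves a point of the disc by at most [1 - r], and [f] is Lipschitz on closed
       discs. *)
    intros rho d Hrho Hd. pose proof (Rabs_pos rho) as Hrho0.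
    destruct (analytic_lipschitz f (Rmax 0 rho) Hf) as (K & HK & HL).
    { split; [apply Rmax_l|apply Rmax_lub_lt; lra]. }
    destruct (dilation_radius_lim (d / (K + 1))) as [N HN]; [apply Rdiv_lt_0_compat; lra|].
    exists N. intros n w Hnn Hw. specialize (HN n Hnn).
    pose proof (dilation_radius_bounds n) as Hr. pose proof (Rmax_r 0 rho).
    assert (Hwd : disc w) by (unfold disc; lra). specialize (Hball n w Hwd).
    eapply Rle_trans; [apply HL; lra|].
    replace (RtoC (dilation_radius n) * w - w)%C with (- (RtoC (1 - dilation_radius n) * w))%C
      by (rewrite RtoC_minus; ring).
    rewrite Cmod_opp, Cmod_mult, Cmod_R, Rabs_pos_eq by lra.
    pose proof (Cmod_ge_0 w).
    apply Rle_trans with ((K + 1) * (d / (K + 1) * 1)); [|right; field; lra].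
    apply Rmult_le_compat; [assumption| |lra|].
    + apply Rmult_le_pos; lra.
    + apply Rmult_le_compat; lra.
Qed.

Lemma volterra_H_infty (g f : C -> C) (v : R -> R) : analytic g -> weight v ->
  filterlim v (at_left 1) (locally 0) ->
  compact_operator (H_zero v) (weighted_norm v) (volterra g) ->
  H_infty v f -> H_zero v (volterra g f).
Proof.
  intros Hg Hv Hlim Hcomp Hf.
  assert (Hfa : analytic f) by apply Hf.
  set (B := weighted_norm v f).
  assert (HB : 0 <= B).
  { eapply Rle_trans; [apply (weighted_modulus_ge_0 v Hv f 0 disc_0)|].
    apply weighted_modulus_le_norm; [apply Hf|apply disc_0]. }
  (* Dividing by [B + 1] rather than [B] also covers functions of norm zero. *)
  set (h := fun z => (RtoC (/ (B + 1)) * f z)%C).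
  assert (HhB : forall z, disc z -> weighted_modulus v h z <= 1).
  { intros z Hz. unfold h. rewrite weighted_modulus_scal, Cmod_R, Rabs_pos_eq.
    2:{ left. apply Rinv_0_lt_compat. lra. }
    pose proof (weighted_modulus_le_norm v f z (proj2 Hf) Hz) as Hle. fold B in Hle.
    rewrite Rmult_comm. apply Rle_div_l; lra. }
  assert (Hha : analytic h) by (apply analytic_scal, Hfa).
  apply (H_zero_ext v Hv (fun z => RtoC (B + 1) * volterra g h z)%C).
  - intros z Hz. unfold h. rewrite (volterra_scal g Hg) by assumption.
    rewrite Cmult_assoc, <- RtoC_mult, Rinv_r by lra. ring.
  - apply (H_zero_scal v Hv). apply volterra_H_infty_unit; try assumption.
    + apply (H_infty_iff v Hv). split; [assumption|]. exists 1. exact HhB.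
    + apply (weighted_sup_bounded v Hv). exact HhB.
Qed.

(** * Lacunary series *)

Section Lacunary.
Variables (g : C -> C) (v : R -> R).
Hypothesis g_analytic : analytic g.
Hypothesis v_weight : weight v.
Hypothesis v_lim : filterlim v (at_left 1) (locally 0).
Hypothesis Vg_compact : compact_operator (H_zero v) (weighted_norm v) (volterra g).

Definition monomial_norm (k : nat) : R := weighted_norm v (fun z => z ^ k)%C.

Lemma monomial_H_zero (k : nat) : H_zero v (fun z => z ^ k)%C.
Proof using v_weight v_lim.
  apply (H_zero_of_bounded v _ 1 v_weight v_lim); [apply analytic_pow|]. intros z Hz.
  rewrite Cmod_pow, <- (pow1 k). apply pow_incr. split; [apply Cmod_ge_0|left; exact Hz].
Qed.

Lemma monomial_norm_ge (k : nat) (s : R) : 0 <= s < 1 -> s ^ k * v s <= monomial_norm k.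
Proof using v_weight v_lim.
  intros Hs.
  assert (Hc : Cmod (RtoC s) = s) by (rewrite Cmod_R; apply Rabs_pos_eq; lra).
  pose proof (weighted_modulus_le_norm v (fun z => z ^ k)%C (RtoC s)
    (proj2 (H_zero_H_infty v v_weight _ (monomial_H_zero k)))) as H.
  unfold weighted_modulus in H. rewrite Cmod_pow, Hc in H. apply H. unfold disc. lra.
Qed.

Lemma monomial_norm_pos (k : nat) : 0 < monomial_norm k.
Proof using v_weight v_lim.
  eapply Rlt_le_trans; [|apply (monomial_norm_ge k (1 / 2)); lra].
  apply Rmult_lt_0_compat; [apply pow_lt; lra|apply (proj1 v_weight); lra].
Qed.

Definition unit_monomial (k : nat) (z : C) : C := (RtoC (/ monomial_norm k) * z ^ k)%C.

Lemma unit_monomial_H_zero (k : nat) : H_zero v (unit_monomial k).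
Proof using v_weight v_lim. apply (H_zero_scal v v_weight), monomial_H_zero. Qed.

Lemma unit_monomial_norm (k : nat) : weighted_norm v (unit_monomial k) <= 1.
Proof using v_weight v_lim.
  apply (weighted_sup_bounded v v_weight). intros z Hz. unfold unit_monomial.
  pose proof (monomial_norm_pos k) as Hp.
  rewrite weighted_modulus_scal, Cmod_R, Rabs_pos_eq by (left; apply Rinv_0_lt_compat, Hp).
  pose proof (weighted_modulus_le_norm v (fun z => z ^ k)%C z
    (proj2 (H_zero_H_infty v v_weight _ (monomial_H_zero k))) Hz) as H.
  fold (monomial_norm k) in H. rewrite Rmult_comm. apply Rle_div_l; lra.
Qed.

(** For [rho < s < 1] the norm of [z ^ n] is at least [s ^ n * v s], so on the disc of radius [rho]
    the normalised monomial is at most [(rho / s) ^ n / v s]. *)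
Lemma unit_monomial_loc_unif : loc_unif unit_monomial (fun _ => 0).
Proof using v_weight v_lim.
  intros rho0 e Hrho0 He.
  set (rho := Rmax 0 rho0). assert (Hrho : 0 <= rho < 1).
  { split; [apply Rmax_l|apply Rmax_lub_lt; lra]. }
  set (s := (rho + 1) / 2). assert (Hs : rho < s < 1) by (unfold s; lra).
  assert (Hvs : 0 < v s) by (apply (proj1 v_weight); lra).
  destruct (pow_lt_1_zero (rho / s)) with (y := e * v s) as [N HN].
  { rewrite Rabs_pos_eq; [apply Rlt_div_l; lra|apply Rdiv_le_0_compat; lra]. }
  { apply Rmult_lt_0_compat; assumption. }
  exists N. intros n w Hn Hw. specialize (HN n Hn).
  replace (unit_monomial n w - 0)%C with (unit_monomial n w) by ring. unfold unit_monomial.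
  pose proof (monomial_norm_pos n) as Hp.
  rewrite Cmod_mult, Cmod_R, Rabs_pos_eq, Cmod_pow by (left; apply Rinv_0_lt_compat, Hp).
  rewrite Rmult_comm. apply Rle_div_l; [assumption|].
  pose proof (monomial_norm_ge n s ltac:(lra)) as Hge.
  pose proof (Rle_abs ((rho / s) ^ n)) as Habs.
  unfold Rdiv in HN, Habs. rewrite Rpow_mult_distr, pow_inv in HN, Habs.
  assert (Hsn : 0 < s ^ n) by (apply pow_lt; lra).
  assert (Hlt : rho ^ n * / s ^ n < e * v s) by lra.
  apply (Rmult_lt_compat_r (s ^ n)) in Hlt; [|assumption].
  rewrite Rmult_assoc, Rinv_l, Rmult_1_r in Hlt by lra.
  assert (Hwn : Cmod w ^ n <= rho ^ n).
  { apply pow_incr. split; [apply Cmod_ge_0|]. eapply Rle_trans; [exact Hw|apply Rmax_r]. }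
  apply (Rmult_le_compat_l e) in Hge; lra.
Qed.

(** The images tend pointwise to the image of the zero function, so zero is the cluster point that
    compactness provides. *)
Lemma volterra_unit_monomial_small (e : R) (n0 : nat) : 0 < e ->
  exists n, (n0 <= n)%nat /\ weighted_norm v (volterra g (unit_monomial n)) < e.
Proof using g_analytic v_weight v_lim Vg_compact.
  intros He.
  destruct (compact_operator_limit v v_weight (volterra g) unit_monomial (fun _ => 0) Vg_compact
    unit_monomial_H_zero unit_monomial_norm) as [_ H].
  { intros z d Hz Hd.
    destruct (volterra_loc_unif g g_analytic unit_monomial (fun _ => 0) z) with (e := d) as [N HN];
      try assumption.
    - intros n. apply unit_monomial_H_zero.
    - apply analytic_const.
    - exact unit_monomial_loc_unif.
    - exists N. intros n Hn. specialize (HN n Hn). rewrite (volterra_zero g g_analytic z Hz) in HN. exact HN. }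
  destruct (H e n0 He) as (n & Hn & Hlt). exists n. split; [assumption|].
  erewrite weighted_norm_ext; [exact Hlt|]. intros z _. simpl. ring.
Qed.

(** The first bound makes the series of images converge in norm, the second makes the series itself
    converge locally uniformly. Indices may repeat; with nonnegative coefficients this does no
    harm. *)
Lemma sparse_indices : exists kappa : nat -> nat, forall n,
  weighted_norm v (volterra g (unit_monomial (kappa n))) <= (1 / 4) ^ n /\
  forall w, Cmod w <= dilation_radius n -> Cmod (unit_monomial (kappa n) w) <= (1 / 4) ^ n.
Proof using g_analytic v_weight v_lim Vg_compact.
  assert (H : forall n, exists k,
    weighted_norm v (volterra g (unit_monomial k)) <= (1 / 4) ^ n /\
    forall w, Cmod w <= dilation_radius n -> Cmod (unit_monomial k w) <= (1 / 4) ^ n).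
  { intros n. assert (Hp : 0 < (1 / 4) ^ n) by (apply pow_lt; lra).
    (* The second bound holds for all indices from [N] on, the first only along a subsequence, so
       the index is taken from that subsequence beyond [N]. *)
    destruct (unit_monomial_loc_unif (dilation_radius n) ((1 / 4) ^ n)) as [N HN];
      [apply dilation_radius_bounds|assumption|].
    destruct (volterra_unit_monomial_small ((1 / 4) ^ n) N Hp) as (k & Hk & Hlt).
    exists k. split; [lra|]. intros w Hw. specialize (HN k w Hk Hw).
    replace (unit_monomial k w - 0)%C with (unit_monomial k w) in HN by ring. exact HN. }
  exists (fun n => proj1_sig (constructive_indefinite_description _ (H n))).
  intros n. exact (proj2_sig (constructive_indefinite_description _ (H n))).
Qed.

Fixpoint lacunary_sum (kappa : nat -> nat) (n : nat) (z : C) : C :=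
  match n with
  | O => 0
  | S m => (lacunary_sum kappa m z + RtoC (2 ^ m) * unit_monomial (kappa m) z)%C
  end.

Lemma lacunary_sum_H_zero (kappa : nat -> nat) (n : nat) : H_zero v (lacunary_sum kappa n).
Proof using v_weight v_lim.
  induction n.
  - apply (H_zero_of_bounded v _ 0 v_weight v_lim); [apply analytic_const|].
    intros z _. simpl. rewrite Cmod_0. lra.
  - apply (H_zero_plus v v_weight); [assumption|].
    apply (H_zero_scal v v_weight), unit_monomial_H_zero.
Qed.

Lemma two_four_pow (n : nat) : 2 ^ n * (1 / 4) ^ n = (1 / 2) ^ n.
Proof using. rewrite <- Rpow_mult_distr. f_equal. field. Qed.

Lemma Cmod_pow2_mult (n : nat) (z : C) : Cmod (RtoC (2 ^ n) * z) = 2 ^ n * Cmod z.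
Proof using. rewrite Cmod_mult, Cmod_R, Rabs_pos_eq; [reflexivity|apply pow_le; lra]. Qed.

(** At a nonnegative real point all terms are nonnegative reals, so the partial sum dominates each
    of them; the sum with index [m] contains the terms below [m], hence [n < m]. *)
Lemma lacunary_sum_lower (kappa : nat -> nat) (r : R) (n m : nat) : 0 <= r -> (n < m)%nat ->
  2 ^ n * (/ monomial_norm (kappa n) * r ^ kappa n) <= fst (lacunary_sum kappa m (RtoC r)).
Proof using v_weight v_lim.
  intros Hr.
  assert (Hterm : forall k, fst (RtoC (2 ^ k) * unit_monomial (kappa k) (RtoC r))%C =
    2 ^ k * (/ monomial_norm (kappa k) * r ^ kappa k)).
  { intros k. unfold unit_monomial. rewrite <- RtoC_pow, <- !RtoC_mult. reflexivity. }
  assert (Hpos : forall k, 0 <= 2 ^ k * (/ monomial_norm (kappa k) * r ^ kappa k)).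
  { intros k. apply Rmult_le_pos; [apply pow_le; lra|]. apply Rmult_le_pos; [|apply pow_le, Hr].
    left. apply Rinv_0_lt_compat, monomial_norm_pos. }
  assert (Hstep : forall k, fst (lacunary_sum kappa (S k) (RtoC r)) =
    fst (lacunary_sum kappa k (RtoC r)) + 2 ^ k * (/ monomial_norm (kappa k) * r ^ kappa k)).
  { intros k. rewrite <- Hterm. reflexivity. }
  assert (Hnn : forall k, 0 <= fst (lacunary_sum kappa k (RtoC r))).
  { induction k; [simpl; lra|]. rewrite Hstep. specialize (Hpos k). lra. }
  induction 1 as [|m Hm IH]; rewrite Hstep.
  - specialize (Hnn n). lra.
  - specialize (Hpos m). lra.
Qed.

Lemma lacunary_witness : exists f, optimal_domain (volterra g) (H_zero v) f /\ ~ H_infty v f.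
Proof using g_analytic v_weight v_lim Vg_compact.
  destruct sparse_indices as [kappa Hkappa].
  set (s := lacunary_sum kappa).
  assert (Hs : forall n, H_zero v (s n)) by (intros n; apply lacunary_sum_H_zero).
  assert (Hsa : forall n, analytic (s n)) by (intros n; apply Hs).
  assert (Hea : forall k, analytic (unit_monomial k)) by (intros k; apply unit_monomial_H_zero).
  assert (HVs : forall n, H_zero v (volterra g (s n))) by (intros n; apply Vg_compact, Hs).
  destruct (loc_unif_geometric s) as [f Hf].
  (* Once [dilation_radius n] exceeds [rho], the [n]-th term is at most [2 ^ n * (1 / 4) ^ n] on the
     disc of radius [rho]. *)
  { intros rho Hrho. destruct (dilation_radius_lim (1 - rho)) as [N HN]; [lra|].
    exists N. intros n w Hn Hw. specialize (HN n Hn).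
    replace (s (S n) w - s n w)%C with (RtoC (2 ^ n) * unit_monomial (kappa n) w)%C
      by (unfold s; simpl; ring).
    rewrite Cmod_pow2_mult, <- two_four_pow.
    apply Rmult_le_compat_l; [apply pow_le; lra|]. apply Hkappa. lra. }
  assert (Hfa : analytic f) by (apply (weierstrass s); assumption).
  (* A weighted tail bound uniform in [z]. It gives locally uniform convergence of the images, hence
     analyticity of [volterra g f], and later its decay at the circle. *)
  assert (Htail : forall n z, disc z ->
     Cmod (volterra g f z - volterra g (s n) z) * v (Cmod z) <= 2 * (1 / 2) ^ n).
  { intros n z Hz. pose proof (weight_pos v v_weight z Hz) as Hv.
    apply le_epsilon. intros e He.
    destruct (volterra_loc_unif g g_analytic s f z Hsa Hfa Hf Hz (e / v (Cmod z))) as [N HN].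
    { apply Rdiv_lt_0_compat; assumption. }
    specialize (HN (max n N) ltac:(lia)).
    apply Rle_div_r in HN; [|assumption].
    pose proof (geometric_telescope (fun k => volterra g (s k) z) (v (Cmod z)) 0 ltac:(lra)) as Hg.
    specialize (fun H => Hg H n (max n N) ltac:(lia) ltac:(lia)). cbv beta in Hg.
    pose proof (Cmod_triangle_minus (volterra g f z) (volterra g (s (max n N)) z) (volterra g (s n) z)) as Ht.
    rewrite (Cmod_minus_sym (volterra g f z) (volterra g (s (max n N)) z)) in Ht.
    apply (Rmult_le_compat_r (v (Cmod z))) in Ht; [|lra].
    rewrite Rmult_plus_distr_r in Ht.
    enough (Cmod (volterra g (s (max n N)) z - volterra g (s n) z) * v (Cmod z) <= 2 * (1 / 2) ^ n) by lra.
    apply Hg. intros k _.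
    replace (volterra g (s (S k)) z) with
      (volterra g (s k) z + RtoC (2 ^ k) * volterra g (unit_monomial (kappa k)) z)%C.
    2:{ rewrite <- (volterra_scal g g_analytic) by (assumption || apply Hea).
        rewrite <- (volterra_plus g g_analytic) by (assumption || apply Hsa || apply analytic_scal, Hea).
        reflexivity. }
    replace (volterra g (s k) z + RtoC (2 ^ k) * volterra g (unit_monomial (kappa k)) z - volterra g (s k) z)%C
      with (RtoC (2 ^ k) * volterra g (unit_monomial (kappa k)) z)%C by ring.
    rewrite Cmod_pow2_mult, Rmult_assoc, <- two_four_pow.
    apply Rmult_le_compat_l; [apply pow_le; lra|].
    eapply Rle_trans; [|apply (proj1 (Hkappa k))].
    apply (weighted_modulus_le_norm v (volterra g (unit_monomial (kappa k)))); [|assumption].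
    apply (H_zero_H_infty v v_weight). apply Vg_compact, unit_monomial_H_zero. }
  assert (HVlu : loc_unif (fun n => volterra g (s n)) (volterra g f)).
  { intros rho0 e Hrho0 He.
    set (rho := Rmax 0 rho0). assert (Hrho : 0 <= rho < 1).
    { split; [apply Rmax_l|apply Rmax_lub_lt; lra]. }
    assert (Hv : 0 < v rho) by (apply (proj1 v_weight); assumption).
    destruct (half_pow_le (e * v rho)) as [N HN]; [apply Rmult_lt_0_compat; assumption|].
    exists N. intros n w Hn Hw. specialize (HN n Hn).
    pose proof (Rmax_r 0 rho0 : rho0 <= rho) as Hr0.
    specialize (Htail n w ltac:(unfold disc; lra)). rewrite Cmod_minus_sym.
    apply Rmult_le_reg_r with (v rho); [assumption|].
    eapply Rle_trans; [|exact HN]. eapply Rle_trans; [|exact Htail].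
    apply Rmult_le_compat_l; [apply Cmod_ge_0|].
    apply (weight_decr v v_weight); [apply Cmod_ge_0|lra|lra]. }
  exists f. split.
  - split; [assumption|]. apply (H_zero_iff v v_weight). split.
    { apply (weierstrass (fun n => volterra g (s n))); [intros n; apply HVs|assumption]. }
    (* Half of [e] pays for the tail after [N], uniformly on the disc; the other half for the decay
       of the image of the partial sum, already in [H_zero]. *)
    intros e He. destruct (half_pow_le (e / 2)) as [N HN]; [lra|]. specialize (HN N (le_n N)).
    destruct (proj2 (proj1 (H_zero_iff v v_weight _) (HVs N)) (e / 2)) as (r & Hr & H); [lra|].
    exists r. split; [assumption|]. intros z Hz. specialize (H z Hz).
    assert (Hzd : disc z) by (unfold disc; lra). specialize (Htail N z Hzd).
    pose proof (weight_pos v v_weight z Hzd) as Hv.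
    unfold weighted_modulus in *.
    pose proof (Cmod_le_add (volterra g f z) (volterra g (s N) z)) as Ht.
    apply (Rmult_le_compat_r (v (Cmod z))) in Ht; [|lra]. rewrite Rmult_plus_distr_r in Ht. lra.
  - intros [_ Hfin]. set (B := weighted_norm v f).
    assert (HB : forall n, 2 ^ n <= B).
    { intros n. pose proof (monomial_norm_pos (kappa n)) as Hc.
      assert (H2 : 0 < 2 ^ n) by (apply pow_lt; lra).
      set (c := monomial_norm (kappa n)) in *.
      (* Since [c] is the supremum of [r ^ kappa n * v r], it suffices to bound each such value by
         [B * c / 2 ^ n]; cancelling [c] then gives [2 ^ n <= B]. *)
      enough (H : c <= B * c / 2 ^ n).
      { apply Rle_div_r in H; [|assumption]. apply Rmult_le_reg_l with c; lra. }
      unfold c at 1. apply (weighted_sup_bounded v v_weight). intros z Hz.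
      unfold weighted_modulus. rewrite Cmod_pow.
      set (r := Cmod z). pose proof (Cmod_ge_0 z : 0 <= r) as Hr0. assert (Hr1 : r < 1) by exact Hz.
      assert (Hv : 0 < v r) by (apply (weight_pos v v_weight z Hz)).
      assert (Hcr : Cmod (RtoC r) = r) by (rewrite Cmod_R; apply Rabs_pos_eq; lra).
      (* The monomial sees only the modulus of [z], so [f] may be tested at the positive real point
         of that modulus, where the partial sums dominate their [n]-th term. *)
      assert (Hlow : 2 ^ n * (/ c * r ^ kappa n) <= Cmod (f (RtoC r))).
      { apply le_epsilon. intros e He. destruct (Hf r e Hr1 He) as [N HN].
        specialize (HN (max N (S n)) (RtoC r) ltac:(lia) ltac:(lra)).
        pose proof (lacunary_sum_lower kappa r n (max N (S n)) Hr0 ltac:(lia)) as Hl.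
        fold s in Hl. fold c in Hl.
        pose proof (Cmod_le_add (s (max N (S n)) (RtoC r)) (f (RtoC r))) as Ht.
        pose proof (re_le_Cmod (s (max N (S n)) (RtoC r))) as Hre. unfold Re in Hre.
        pose proof (Rle_abs (fst (s (max N (S n)) (RtoC r)))). lra. }
      pose proof (weighted_modulus_le_norm v f (RtoC r) Hfin) as Hle. fold B in Hle.
      unfold weighted_modulus in Hle. rewrite Hcr in Hle. unfold disc in Hle. rewrite Hcr in Hle.
      specialize (Hle Hr1).
      apply (Rmult_le_compat_r (v r)) in Hlow; [|lra].
      apply Rmult_le_reg_r with (2 ^ n); [assumption|].
      replace (B * c / 2 ^ n * 2 ^ n) with (B * c) by (field; lra).
      apply Rle_trans with (2 ^ n * (/ c * r ^ kappa n) * v r * c); [right; field; lra|].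
      apply Rmult_le_compat_r; lra. }
    destruct (Pow_x_infinity 2) with (b := B + 1) as [N HN].
    { rewrite Rabs_pos_eq; lra. }
    specialize (HN N (le_n N)). rewrite Rabs_pos_eq in HN by (apply pow_le; lra).
    specialize (HB N). lra.
Qed.
End Lacunary.

Theorem proposition3p5 (g : C -> C) (v : R -> R)
  (g_analytic : analytic g)
  (g_non_constant : non_constant g)
  (v_weight : weight v)
  (v_log_convex : log_convex v)
  (v_lim : filterlim v (at_left 1) (locally 0))
  (v_growth : exists alpha r0 : R, 0 < alpha /\ 0 < r0 < 1 /\
    increasing_on (fun r : R => r0 <= r < 1)
      (fun r : R => v r * Rpower (1 - r) (- alpha)))
  (Vg_compact : compact_operator (H_zero v) (weighted_norm v) (volterra g)) :
  proper_subspace (H_infty v) (optimal_domain (volterra g) (H_zero v)).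
Proof.
  split; [|split; [|split]].
  - split; [|split].
    + apply (H_infty_iff v v_weight). split; [apply analytic_const|]. exists 0. intros z _.
      unfold weighted_modulus. rewrite Cmod_0. lra.
    + intros f h Hf Hh. apply (H_infty_iff v v_weight) in Hf, Hh.
      destruct Hf as [Hf [B1 H1]]. destruct Hh as [Hh [B2 H2]].
      apply (H_infty_iff v v_weight). split; [apply analytic_plus; assumption|].
      exists (B1 + B2). intros z Hz.
      eapply Rle_trans; [apply (weighted_modulus_plus v v_weight); assumption|].
      specialize (H1 z Hz). specialize (H2 z Hz). lra.
    + intros c f Hf. apply (H_infty_iff v v_weight) in Hf. destruct Hf as [Hf [B H]].
      apply (H_infty_iff v v_weight). split; [apply analytic_scal; assumption|].
      exists (Cmod c * B). intros z Hz. rewrite weighted_modulus_scal.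
      apply Rmult_le_compat_l; [apply Cmod_ge_0|apply H, Hz].
  - split; [|split].
    + split; [apply analytic_const|].
      (* Linearity of [volterra] is established on the disc only, so membership is transferred along
         equality there. *)
      apply (H_zero_ext v v_weight (fun _ => 0)).
      * intros z Hz. symmetry. apply volterra_zero; assumption.
      * apply (H_zero_of_bounded v _ 0 v_weight v_lim); [apply analytic_const|].
        intros z _. rewrite Cmod_0. lra.
    + intros f h [Hf HVf] [Hh HVh]. split; [apply analytic_plus; assumption|].
      apply (H_zero_ext v v_weight (fun z => volterra g f z + volterra g h z)%C).
      * intros z Hz. symmetry. apply volterra_plus; assumption.
      * apply (H_zero_plus v v_weight); assumption.
    + intros c f [Hf HVf]. split; [apply analytic_scal; assumption|].
      apply (H_zero_ext v v_weight (fun z => c * volterra g f z)%C).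
      * intros z Hz. symmetry. apply volterra_scal; assumption.
      * apply (H_zero_scal v v_weight); assumption.
  - intros f Hf. split; [apply Hf|]. apply volterra_H_infty; assumption.
  - apply lacunary_witness; assumption.
Qed.
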